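(* Let $I$ be a quasiconcave function satisfying $\int_0^t\frac{I(s)}{s}ds\lesssim I(t)$ for $t\in(0,1)$, and let $X$ be an r.i. space. Define $\|f\|_Z=\|S_If\|_{X'}$ for $f\in\mathcal M_+(0,1)$. Then $$\|f\|_{(Y_X)'}=\left\|\frac1{I(t)}\int_0^tf^*(s)ds\right\|_{X'}\approx\left\|\frac1{I(t)}\int_0^tf^*(s)ds\right\|_Z,\quad f\in\mathcal M_+(0,1),$$ and $S_I$ is bounded on $Z$.
   Context: Functions live on $(0,1)$; $\mathcal M_+(0,1)$ nonnegative measurable functions; $f^*$ nonincreasing rearrangement. An r.i. space is a rearrangement-invariant Banach function space on $(0,1)$; $X'$ its associate space ($\|g\|_{X'}=\sup_{\|f\|_X\le1}\int fg$). A quasiconcave function is a nondecreasing bijection $I:(0,1)\to(0,1)$ with $I(0+)=0$, $I(1-)=1$ and $I(t)/t$ nonincreasing. $S_If(t)=\frac1{I(t)}\sup_{0<s\le t}I(s)f^*(s)$; $H_If(t)=\int_t^1\frac{f(s)}{I(s)}ds$. $Y_X$ is the optimal target space of $X$ under $H_I$: $H_I:X\to Y_X$ bounded and $Y_X\hookrightarrow W$ for every r.i. $W$ with $H_I:X\to W$ bounded; $(Y_X)'$ is its associate space. Boundedness of $S_I$ on $Z$ means $\|S_If\|_Z\lesssim\|f\|_Z$. $\approx$: two-sided inequality with constants independent of $f$. *)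

(* Defs.v *)
(* Functions on (0,1) are modelled as
   f : R -> \bar R ; only their values on ]0,1[ matter. *)
From HB Require Import structures.
From mathcomp Require Import all_boot all_order all_algebra.
From mathcomp Require Import all_classical all_reals all_analysis measurable_realfun.
Set Implicit Arguments. Unset Strict Implicit. Unset Printing Implicit Defensive.
Import Order.TTheory GRing.Theory Num.Theory.
Import numFieldNormedType.Exports.
Local Open Scope classical_set_scope.
Local Open Scope ring_scope.
Local Open Scope ereal_scope.

Section Defs.
Variable R : realType.
Local Notation mu := (@lebesgue_measure R).

Definition I01 : set R := `]0%R, 1%R[.

Definition Mplus (f : R -> \bar R) : Prop :=
  measurable_fun I01 f /\ (forall x, I01 x -> 0 <= f x).

Definition distr (f : R -> \bar R) (l : R) : \bar R :=
  mu (I01 `&` [set x | l%:E < f x]).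

Definition fstar (f : R -> \bar R) (t : R) : \bar R :=
  ereal_inf [set l%:E | l in [set l : R | (0 <= l)%R /\ distr f l <= t%:E]].

Definition ae_zero (f : R -> \bar R) : Prop :=
  mu.-negligible (I01 `&` [set x | f x != 0]).

(* rearrangement-invariant Banach function norm on M_+(0,1)
   (axioms (P1)-(P5) of Bennett--Sharpley, plus rearrangement invariance).
   An r.i. space X is identified with its norm rho (||f||_X = rho |f|). *)
Definition ri_norm (rho : (R -> \bar R) -> \bar R) : Prop :=
  (forall f, Mplus f -> 0 <= rho f) /\
  (forall f, Mplus f -> (rho f = 0 <-> ae_zero f)) /\
  (forall f (a : R), Mplus f -> (0 <= a)%R ->
      rho (fun x => a%:E * f x) = a%:E * rho f) /\
  (forall f g, Mplus f -> Mplus g -> rho (f \+ g) <= rho f + rho g) /\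
  (forall f g, Mplus f -> Mplus g ->
      {ae mu, forall x, I01 x -> g x <= f x} -> rho g <= rho f) /\
  (forall (fn : nat -> R -> \bar R) f, (forall n, Mplus (fn n)) -> Mplus f ->
      {ae mu, forall x, I01 x -> (forall n, fn n x <= fn n.+1 x) /\
                                  fn ^~ x @ \oo --> f x} ->
      rho \o fn @ \oo --> rho f) /\
  (forall E, measurable E -> E `<=` I01 ->
      rho (fun x => ((\1_E x : R))%:E) < +oo) /\
  (forall E, measurable E -> E `<=` I01 ->
      exists C : R, forall f, Mplus f ->
        \int[mu]_(x in E) f x <= C%:E * rho f) /\
  (forall f g, Mplus f -> Mplus g -> (forall l : R, distr f l = distr g l) ->
      rho f = rho g).

Definition assoc (rho : (R -> \bar R) -> \bar R) (g : R -> \bar R) : \bar R :=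
  ereal_sup [set (\int[mu]_(x in I01) (f x * g x)) | f in
              [set f | Mplus f /\ rho f <= 1]].

Definition equiv_on_Mplus (A B : (R -> \bar R) -> \bar R) : Prop :=
  exists C : R, (0 < C)%R /\
    forall f, Mplus f -> A f <= C%:E * B f /\ B f <= C%:E * A f.

Definition quasiconcave (I : R -> R) : Prop :=
  {in I01 &, {homo I : s t / (s <= t)%R}} /\
  (forall t, I01 t -> I01 (I t)) /\
  {in I01 &, injective I} /\
  (forall y, I01 y -> exists2 t, I01 t & I t = y) /\
  (I x @[x --> (0%R : R)^'+] --> (0%R : R)) /\
  (I x @[x --> (1%R : R)^'-] --> (1%R : R)) /\
  (forall s t, I01 s -> I01 t -> (s <= t)%R -> (I t / t <= I s / s)%R).

Definition S_I (I : R -> R) (f : R -> \bar R) (t : R) : \bar R :=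
  ((I t)^-1)%:E *
    ereal_sup [set (I s)%:E * fstar f s | s in `]0%R, t]].

Definition H_I (I : R -> R) (f : R -> \bar R) (t : R) : \bar R :=
  \int[mu]_(s in `]t, 1%R[) (f s * ((I s)^-1)%:E).

Definition avgI (I : R -> R) (f : R -> \bar R) (t : R) : \bar R :=
  ((I t)^-1)%:E * \int[mu]_(s in `]0%R, t[) fstar f s.

Definition bounded_op (T : (R -> \bar R) -> (R -> \bar R))
  (rhoX rhoW : (R -> \bar R) -> \bar R) : Prop :=
  exists C : R, forall f, Mplus f -> rhoW (T f) <= C%:E * rhoX f.

Definition embeds (rhoY rhoW : (R -> \bar R) -> \bar R) : Prop :=
  exists C : R, forall f, Mplus f -> rhoW f <= C%:E * rhoY f.

Definition optimal_target (I : R -> R) (rhoX rhoY : (R -> \bar R) -> \bar R)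
  : Prop :=
  ri_norm rhoY /\ bounded_op (H_I I) rhoX rhoY /\
  (forall rhoW, ri_norm rhoW -> bounded_op (H_I I) rhoX rhoW ->
     embeds rhoY rhoW).

End Defs.

(* Main.v *)
(* With H = H_I and N f = ||(1/I) int_0^t f^*||_{X'}, Tonelli gives
   N f = sup { int f^* (H g) : ||g||_X <= 1 }.  The optimal target norm is the
   supremum of all rearrangement-invariant seminorms with the Fatou property
   that are dominated by ||.||_X on the functions H g.  One of these is
   h |-> sup { k int b h : k N b <= 1 }, which yields ||.||_{Y'} <= N; the
   converse holds because H g has a rearrangement h with
   int h f = int (H g)^* f^* (resonance), so that the Lorentz-Luxemburg theorem
   is not needed.  Resonance comes from ranking the points of (0,1) by
   decreasing values of the other function.
   For u = (1/I) int_0^t f^*, concavity of the primitive of f^* gives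
   u > l/2 on (r/2, r) whenever u r > l; hence |{S_I u > l}| <= 2 |{u > l/2}|,
   and dilations are bounded on X'.  Finally S_I (S_I f) <= S_I f pointwise. *)
Require Import Defs.
From HB Require Import structures.
From mathcomp Require Import all_boot all_order all_algebra.
From mathcomp Require Import all_classical all_reals all_analysis measurable_realfun.
From mathcomp Require Import ring lra.
Set Implicit Arguments. Unset Strict Implicit. Unset Printing Implicit Defensive.
Import Order.TTheory GRing.Theory Num.Theory.
Import numFieldNormedType.Exports.
Local Open Scope classical_set_scope.
Local Open Scope ring_scope.
Local Open Scope ereal_scope.

(** * Tonelli and the layer cake formula *)

(** An optimal target is determined only up to equivalence of norms, so the identity for $(Y_X)'$ is
    an equality for one representative and an equivalence for all others. The representative is
    normalized by the constant 1 on the range of $H$, which is what makes the equality exact. The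
    supremum runs over seminorms, so that the nondegeneracy axioms are checked only once, for the
    supremum. From below, the constant function $b = 1$ is admissible, since $t \le I(t)$ gives
    $N(1) < \infty$. From above, the norm of 1 is controlled because $H$ maps the indicator of
    $(1/2, 1)$ to a function that is at least $1/2$ on $(0, 1/2]$. The obstacle in resonance is
    plateaus: where $h$ is constant, its values do not order the points. Ties are broken by position
    on the line; the measure of the set of predecessors of a point is then uniformly distributed on
    $(0,1)$, whatever the jumps and plateaus of $h$. *)

Section layer_cake.
Variable R : realType.
Local Notation mu := (@lebesgue_measure R).
Local Notation I01 := (@Defs.I01 R).
Implicit Types (f g h u v : R -> \bar R).

Lemma measurable_I01 : measurable I01.
Proof. exact: measurable_itv. Qed.
Local Hint Resolve measurable_I01 : core.

Lemma I01P (x : R) : I01 x = (0 < x < 1)%R.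
Proof. by rewrite /I01 /= in_itv. Qed.

Lemma Mplus_measurable f : Mplus f -> measurable_fun I01 f.
Proof. by case. Qed.

Lemma Mplus_ge0 f : Mplus f -> forall x, I01 x -> 0 <= f x.
Proof. by case. Qed.

Lemma MplusM f g : Mplus f -> Mplus g -> Mplus (f \* g).
Proof.
move=> [mf f0] [mg g0]; split; first exact: emeasurable_funM.
by move=> x x01; rewrite mule_ge0 ?f0 ?g0.
Qed.

Lemma Mplus_cst (a : R) : (0 <= a)%R -> Mplus (cst a%:E : R -> \bar R).
Proof. by move=> a0; split=> [|x _]; [exact: measurable_cst|rewrite lee_fin]. Qed.

Lemma MplusZ (a : R) f : (0 <= a)%R -> Mplus f -> Mplus (fun x => a%:E * f x).
Proof. by move=> a0 Mf; exact: (MplusM (Mplus_cst a0) Mf). Qed.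

Lemma measurable_superlevel f (l : \bar R) :
  Mplus f -> measurable (I01 `&` [set x | l < f x]).
Proof. by move=> [mf _]; apply: measurable_lte => //; exact: measurable_cst. Qed.

Lemma mu_I01 : mu I01 = 1.
Proof. by rewrite /I01 lebesgue_measure_itv/= lte_fin ltr01 oppr0 adde0. Qed.

Lemma integralZ (D : set R) (a : R) f : measurable D -> (0 <= a)%R ->
  measurable_fun D f -> (forall x, D x -> 0 <= f x) ->
  \int[mu]_(x in D) (a%:E * f x) = a%:E * \int[mu]_(x in D) f x.
Proof. by move=> mD a0 mf f0; rewrite ge0_integralZl. Qed.

Section tonelli_on.
Variables (D E : set R) (mD : measurable D) (mE : measurable E).
Variable K : R -> R -> \bar R.
Hypothesis mK : measurable_fun (D `*` E) (fun z => K z.1 z.2).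
Hypothesis K0 : forall x y, D x -> E y -> 0 <= K x y.

(** Extension by zero reduces the exchange of integrals over [D] and [E] to the one over the whole
    plane. *)
Let K' := (fun z => K z.1 z.2) \_ (D `*` E).

Let mK' : measurable_fun setT K'.
Proof. by apply/(measurable_restrictT _ _).1 => //; exact: measurableX. Qed.

Let K'0 z : 0 <= K' z.
Proof. by apply: erestrict_ge0 => -[x y] [Dx Ey]; exact: K0. Qed.

Let inner1 x : D x -> \int[mu]_y K' (x, y) = \int[mu]_(y in E) K x y.
Proof.
move=> Dx; rewrite [RHS]integral_mkcond; apply: eq_integral => y _.
rewrite /K' /patch; case: ifPn => [/set_mem[_ Ey]|].
  by rewrite ifT// inE.
move=> DE; rewrite ifF//; apply: contraNF DE => /set_mem Ey.
by rewrite inE.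
Qed.

Let inner2 y : E y -> \int[mu]_x K' (x, y) = \int[mu]_(x in D) K x y.
Proof.
move=> Ey; rewrite [RHS]integral_mkcond; apply: eq_integral => x _.
rewrite /K' /patch; case: ifPn => [/set_mem[Dx _]|].
  by rewrite ifT// inE.
move=> DE; rewrite ifF//; apply: contraNF DE => /set_mem Dx.
by rewrite inE.
Qed.

Lemma tonelli_on : \int[mu]_(x in D) \int[mu]_(y in E) K x y =
                   \int[mu]_(y in E) \int[mu]_(x in D) K x y.
Proof.
have := @fubini_tonelli _ _ _ _ R mu mu K' mK' K'0.
have -> : \int[mu]_x \int[mu]_y K' (x, y) =
          \int[mu]_(x in D) \int[mu]_(y in E) K x y.
  rewrite [RHS]integral_mkcond; apply: eq_integral => x _.
  rewrite [RHS]/patch; case: ifPn => [/set_mem/inner1//|Dx].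
  apply: integral0_eq => y _; rewrite /K' /patch ifF//.
  by apply: contraNF Dx => /set_mem[]; rewrite inE.
have -> // : \int[mu]_y \int[mu]_x K' (x, y) =
          \int[mu]_(y in E) \int[mu]_(x in D) K x y.
rewrite [RHS]integral_mkcond; apply: eq_integral => x _.
rewrite [RHS]/patch; case: ifPn => [/set_mem/inner2//|Dx].
apply: integral0_eq => y _; rewrite /K' /patch ifF//.
by apply: contraNF Dx => /set_mem[]; rewrite inE.
Qed.

Lemma measurable_inner_integral :
  measurable_fun E (fun y => \int[mu]_(x in D) K x y).
Proof.
have := @measurable_fun_fubini_tonelli_G _ _ _ _ R mu K' mK' K'0.
move=> /(measurable_funS measurableT (@subsetT _ E)).
by apply: eq_measurable_fun => y /set_mem/inner2.
Qed.

End tonelli_on.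

Lemma measurable_fun_fst (D E : set R) (f : R -> \bar R) : measurable E ->
  measurable D -> measurable_fun D f -> measurable_fun (D `*` E) (fun z => f z.1).
Proof.
move=> mE mD mf; apply: (@measurable_comp _ _ _ _ _ _ D f _ fst) => //.
  by move=> _ [[x y] [Dx _] <-].
exact: measurable_funTS measurable_fst.
Qed.

Lemma measurable_fun_snd (D E : set R) (f : R -> \bar R) : measurable E ->
  measurable D -> measurable_fun E f -> measurable_fun (D `*` E) (fun z => f z.2).
Proof.
move=> mE mD mf; apply: (@measurable_comp _ _ _ _ _ _ E f _ snd) => //.
  by move=> _ [[x y] [_ Ey] <-].
exact: measurable_funTS measurable_snd.
Qed.

Local Notation pos := (`]0%R, +oo[%classic : set R).

(** The positive levels below [a] have total length [a]. Both [a] and [b] may be [+oo]; the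
    convention [0 * +oo = 0] matches the empty set of levels when [a = 0]. *)
Lemma integral_superlevel (a b : \bar R) : 0 <= a -> 0 <= b ->
  \int[mu]_(l in pos) (if l%:E < a then b else 0) = a * b.
Proof.
move=> a0 b0.
have -> : \int[mu]_(l in pos) (if l%:E < a then b else 0) =
   \int[mu]_(l in pos `&` [set l | l%:E < a]) b.
  rewrite integral_mkcondr; apply: eq_integral => l _.
  rewrite /patch; case: ifPn => la; first by rewrite ifT// inE.
  by rewrite ifF//; apply: contraNF la; rewrite inE.
have mA : measurable (pos `&` [set l : R | l%:E < a]).
  by apply: measurable_lte => //; exact: measurable_cst.
transitivity (b * mu (pos `&` [set l : R | l%:E < a])); first by rewrite integral_cst.
case: a a0 mA => [a| |//]; rewrite ?lee_fin => a0 mA.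
- have -> : pos `&` [set l : R | l%:E < a%:E] = [set` `]0%R, a[].
    by apply/seteqP; split => l /=; rewrite !in_itv/= andbT lte_fin => /andP.
  rewrite lebesgue_measure_itv/= lte_fin; case: ltP => [_|a0'].
    by rewrite oppr0 adde0 muleC.
  by have -> : a = 0%R by [apply/eqP; rewrite eq_le a0 a0']; rewrite mule0 mul0e.
- have -> : pos `&` [set l : R | l%:E < +oo] = pos.
    by apply/seteqP; split => l //=; [move=> []|rewrite ltry].
  by rewrite lebesgue_measure_itv/= ltry /= muleC.
Qed.

Let lc f w (x l : R) : \bar R := if l%:E < f x then w x else 0.

Let measurable_lc f w : Mplus f -> Mplus w ->
  measurable_fun (I01 `*` pos) (fun z => lc f w z.1 z.2).
Proof.
move=> [mf _] [mw _].
have mX : measurable (I01 `*` pos) by apply: measurableX.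
apply: measurable_fun_if => //.
- apply: measurable_fun_lte; last exact: measurable_fun_fst.
  by apply: measurable_fun_snd => //; exact: EFin_measurable.
- by apply: (measurable_funS mX); [exact: subIsetl|exact: measurable_fun_fst].
Qed.

Lemma layer_cake1 f w : Mplus f -> Mplus w ->
  \int[mu]_(x in I01) (f x * w x) =
  \int[mu]_(l in pos) \int[mu]_(x in I01) lc f w x l.
Proof.
move=> Mf Mw.
rewrite -(tonelli_on _ _ (measurable_lc Mf Mw))//; last first.
  by move=> x l x01 _; rewrite /lc; case: ifP => // _; exact: Mplus_ge0.
apply: eq_integral => x /set_mem x01.
by rewrite integral_superlevel//; exact: Mplus_ge0.
Qed.

Lemma layer_cake1_le (c : R) f1 w1 f2 w2 : (0 <= c)%R ->
  Mplus f1 -> Mplus w1 -> Mplus f2 -> Mplus w2 ->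
  (forall l : R, (0 < l)%R ->
     \int[mu]_(x in I01) (if l%:E < f1 x then w1 x else 0) <=
     c%:E * \int[mu]_(x in I01) (if l%:E < f2 x then w2 x else 0)) ->
  \int[mu]_(x in I01) (f1 x * w1 x) <= c%:E * \int[mu]_(x in I01) (f2 x * w2 x).
Proof.
move=> c0 Mf1 Mw1 Mf2 Mw2 H.
have lc0 f w : Mplus f -> Mplus w -> forall l x, I01 x -> 0 <= lc f w x l.
  by move=> _ Mw l x x01; rewrite /lc; case: ifP => // _; exact: Mplus_ge0.
have mint f w : Mplus f -> Mplus w ->
    measurable_fun pos (fun l => \int[mu]_(x in I01) lc f w x l).
  move=> Mf Mw; apply: measurable_inner_integral => //.
  - exact: measurable_lc.
  - by move=> x l x01 _; exact: lc0.
have int0 f w : Mplus f -> Mplus w ->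
    forall l, pos l -> 0 <= \int[mu]_(x in I01) lc f w x l.
  by move=> Mf Mw l _; apply: integral_ge0 => x; exact: lc0.
rewrite !layer_cake1//.
rewrite -(integralZ _ c0 (mint _ _ Mf2 Mw2) (int0 _ _ Mf2 Mw2))//.
apply: ge0_le_integral => //.
- exact: int0.
- exact: mint.
- by apply: emeasurable_funM; [exact: measurable_cst|exact: mint].
- by move=> l /=; rewrite in_itv/= andbT => l0; exact: H.
Qed.

Lemma Mplus_indic_superlevel f (l : R) : Mplus f ->
  Mplus (fun x => if l%:E < f x then 1 else 0 : \bar R).
Proof.
move=> [mf _]; split=> [|x _]; last by case: ifP.
apply: measurable_fun_if => //; exact: measurable_fun_lte.
Qed.

(** A product integral depends monotonically on the measures of the joint superlevel sets: the layer
    cake formula is applied to one factor after the other. *)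
Lemma layer_cake_le (c : R) f1 g1 f2 g2 : (0 <= c)%R ->
  Mplus f1 -> Mplus g1 -> Mplus f2 -> Mplus g2 ->
  (forall l m : R, (0 < l)%R -> (0 < m)%R ->
     mu (I01 `&` [set x | l%:E < f1 x /\ m%:E < g1 x]) <=
     c%:E * mu (I01 `&` [set x | l%:E < f2 x /\ m%:E < g2 x])) ->
  \int[mu]_(x in I01) (f1 x * g1 x) <= c%:E * \int[mu]_(x in I01) (f2 x * g2 x).
Proof.
move=> c0 Mf1 Mg1 Mf2 Mg2 H; apply: layer_cake1_le => // l l0.
pose i f x : \bar R := if l%:E < f x then 1 else 0.
have swap f g : \int[mu]_(x in I01) (if l%:E < f x then g x else 0) =
    \int[mu]_(x in I01) (g x * i f x).
  by apply: eq_integral => x _; rewrite /i; case: ifP; rewrite ?mule1 ?mule0.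
have level f g (m : R) : Mplus f -> Mplus g ->
    \int[mu]_(x in I01) (if m%:E < g x then i f x else 0) =
    mu (I01 `&` [set x | l%:E < f x /\ m%:E < g x]).
  move=> Mf Mg; set A := _ `&` _.
  have mA : measurable A.
    have -> : A = (I01 `&` [set x | l%:E < f x]) `&` (I01 `&` [set x | m%:E < g x]).
      by apply/seteqP; split => [x [? []]|x [[? ?] []]].
    by apply: measurableI; exact: measurable_superlevel.
  rewrite -[in RHS](setIidl (_ : A `<=` I01)); last by move=> x [].
  rewrite -integral_indic//; apply: eq_integral => x /set_mem x01.
  rewrite indicE /i; case: ifPn => [mg|mg].
    case: ifPn => fl; first by rewrite mem_set.
    by rewrite memNset// => -[_ [/= fl' _]]; rewrite fl' in fl.
  by rewrite memNset// => -[_ [/= _ mg']]; rewrite mg' in mg.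
(* The first factor is now an indicator; it becomes the weight, and the second factor is the one cut
   into layers. *)
rewrite !swap; apply: layer_cake1_le => //; [exact: Mplus_indic_superlevel..|].
by move=> m m0; rewrite !level//; exact: H.
Qed.

End layer_cake.

(** * Nonincreasing rearrangement *)

Section nonincreasing_rearrangement.
Variable R : realType.
Local Notation mu := (@lebesgue_measure R).
Local Notation I01 := (@Defs.I01 R).
Implicit Types (f g h u v k : R -> \bar R).
Local Hint Resolve measurable_I01 : core.

Lemma distrE f l : distr f l = mu (I01 `&` [set x | l%:E < f x]).
Proof. by []. Qed.

Lemma distr_ge0 f l : 0 <= distr f l.
Proof. exact: measure_ge0. Qed.

Lemma le_mu (A B : set R) : measurable A -> measurable B -> A `<=` B ->
  mu A <= mu B.
Proof. by move=> mA mB AB; apply: le_measure; rewrite ?inE. Qed.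

Lemma distr_le1 f l : Mplus f -> distr f l <= 1.
Proof.
move=> Mf; rewrite -(mu_I01 R) distrE; apply: le_mu => [| |x []//].
  exact: measurable_superlevel.
exact: measurable_I01.
Qed.

Lemma distr_nincr f (l m : R) : Mplus f -> (l <= m)%R -> distr f m <= distr f l.
Proof.
move=> Mf lm; rewrite !distrE; apply: le_mu; [exact: measurable_superlevel..|].
by move=> x [x01 /= mx]; split=> //=; apply: le_lt_trans mx; rewrite lee_fin.
Qed.

Lemma cvg_le_mu (A : (set R)^nat) (t : \bar R) : (forall n, measurable (A n)) ->
  {homo A : n m / (n <= m)%N >-> n `<=` m} -> (forall n, mu (A n) <= t) ->
  mu (\bigcup_n A n) <= t.
Proof.
move=> mA ndA At.
have /cvg_lim cA : mu \o A @ \oo --> mu (\bigcup_n A n).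
  apply: nondecreasing_cvg_mu => [//| |n m nm]; last exact/subsetPset/ndA.
  by apply: bigcup_measurable => n _; exact: mA.
rewrite -cA//; apply: lime_le; last by apply: nearW => n; exact: At.
apply: ereal_nondecreasing_is_cvgn => n m nm.
by apply: le_mu => //; exact: ndA.
Qed.

Lemma exists_harmonic_lt (e : R) : (0 < e)%R -> exists n, (n.+1%:R^-1 < e)%R.
Proof.
move=> e0; exists (Num.truncn e^-1).
by rewrite invf_plt ?posrE// truncnS_gt.
Qed.

Lemma exists_between_EFin (l : R) (y : \bar R) : l%:E < y ->
  exists n, (l + n.+1%:R^-1)%:E < y.
Proof.
case: y => [y| |//]; last by exists 0%N; rewrite ltry.
rewrite lte_fin -subr_gt0 => /exists_harmonic_lt[n ny].
by exists n; rewrite lte_fin -ltrBrDl.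
Qed.

(** This inverse relation carries all later computations with $f^*$. Strictness from right to left
    is right continuity of the distribution function: the superlevel set at [l] is the increasing
    union of those at $l + 1/(n+1)$, so one of these still has measure above [t]. *)
Lemma fstar_gt f (l t : R) : Mplus f -> (0 <= l)%R ->
  (l%:E < fstar f t) = (t%:E < distr f l).
Proof.
move=> Mf l0; apply/idP/idP.
  by apply: contraTT; rewrite -!leNgt => lt; apply: ereal_inf_lbound; exists l.
move=> tl.
have [n tn] : exists n, t%:E < distr f (l + n.+1%:R^-1).
  apply/not_existsP => H.
  have : distr f l <= t%:E.
    pose A n := I01 `&` [set x | (l + n.+1%:R^-1)%:E < f x].
    have -> : distr f l = mu (\bigcup_n A n).
      rewrite distrE; congr (mu _); apply/seteqP; split => [x [x01 /=]|x [n _ [x01 /=]]].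
        by move=> /exists_between_EFin[n nx]; exists n.
      by move=> nx; split=> //=; apply: le_lt_trans nx; rewrite lee_fin lerDl.
    apply: cvg_le_mu.
    - by move=> n; exact: measurable_superlevel.
    - move=> n m nm x [x01 /= nx]; split=> //=; apply: le_lt_trans nx.
      by rewrite lee_fin lerD2l lef_pV2 ?posrE// ler_nat.
    - by move=> n; rewrite leNgt; apply/negP; exact: H.
  by rewrite leNgt tl.
apply: (@lt_le_trans _ _ (l + n.+1%:R^-1)%:E); first by rewrite lte_fin ltrDl.
apply: le_ereal_inf_tmp => _ [m [m0 mt] <-]; rewrite lee_fin leNgt.
apply: contraTN tn => mn; rewrite -leNgt (le_trans _ mt)//.
exact/distr_nincr/ltW.
Qed.

Lemma fstar_ge0 f t : 0 <= fstar f t.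
Proof. by apply: le_ereal_inf_tmp => _ [l [l0 _] <-]; rewrite lee_fin. Qed.

Lemma fstar_nincr f (s t : R) : (s <= t)%R -> fstar f t <= fstar f s.
Proof.
move=> st; apply: le_ereal_inf => _ [l [l0 ls] <-]; exists l => //; split=> //.
by rewrite (le_trans ls)// lee_fin.
Qed.

Lemma eq_fstar f g : (forall l, distr f l = distr g l) -> fstar f = fstar g.
Proof. by move=> fg; apply/funext => t; rewrite /fstar; under eq_set do rewrite fg. Qed.

Definition nincr01 k := forall s t, I01 s -> I01 t -> (s <= t)%R -> k t <= k s.

Lemma nincr01_fstar f : nincr01 (fstar f).
Proof. by move=> s t _ _; exact: fstar_nincr. Qed.

(** The part of $(0,1)$ where [k] exceeds a given level is an interval. *)
Lemma Mplus_nincr01 k : nincr01 k -> (forall x, I01 x -> 0 <= k x) -> Mplus k.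
Proof.
move=> nk k0; split=> // _; apply: (measurability _ (ErealGenOInfty.measurableE R)); last exact: measurable_I01.
move=> /= _ [_ [a ->]] <-; apply: is_interval_measurable => s t.
move=> [s01 /= sa] [t01 /= ta] x /andP[sx xt].
have x01 : I01 x.
  move: s01 t01; rewrite !I01P => /andP[s0 _] /andP[_ t1].
  by rewrite (lt_le_trans s0 sx) (le_lt_trans xt t1).
move: sa ta; rewrite !in_itv/= !andbT => _ ta; split; first exact: x01.
by rewrite /= (lt_le_trans ta)// nk.
Qed.

Lemma Mplus_fstar f : Mplus (fstar f).
Proof. by apply: Mplus_nincr01 => [|x _]; [exact: nincr01_fstar|exact: fstar_ge0]. Qed.

Lemma mu_lt_I01 (d : \bar R) : 0 <= d <= 1 -> mu (I01 `&` [set t | t%:E < d]) = d.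
Proof.
case: d => [d| |]; rewrite ?leye_eq ?andbF// !lee_fin => /andP[d0 d1].
have -> : I01 `&` [set t : R | t%:E < d%:E] = [set` `]0%R, d[].
  apply/seteqP; split => t /=; rewrite I01P in_itv/= lte_fin.
    by move=> [/andP[-> _]].
  by move=> /andP[t0 td]; rewrite t0 td (lt_le_trans td).
rewrite lebesgue_measure_itv/= lte_fin; case: ltP => [_|d0'].
  by rewrite oppr0 adde0.
by congr EFin; apply/eqP; rewrite eq_le d0 d0'.
Qed.

Lemma superlevel_lt0 f (l : R) : (l < 0)%R -> (forall x, I01 x -> 0 <= f x) ->
  I01 `&` [set x | l%:E < f x] = I01.
Proof.
move=> l0 f0; apply/seteqP; split=> [x []//|x x01]; split=> //=.
by apply: lt_le_trans (f0 _ x01); rewrite lte_fin.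
Qed.

(** By [fstar_gt] the set where $f^* > l$ consists of the $t$ in $(0,1)$ with [t%:E < distr f l];
    for negative [l] both superlevel sets are all of $(0,1)$. *)
Lemma distr_fstar f l : Mplus f -> distr (fstar f) l = distr f l.
Proof.
move=> Mf; have [l0|l0] := leP 0%R l; last first.
  by rewrite !distrE !superlevel_lt0// => x x01; [exact: Mplus_ge0|exact: fstar_ge0].
rewrite -[RHS]mu_lt_I01 ?distr_ge0 ?distr_le1//.
by rewrite distrE; congr (mu (_ `&` _)); apply/seteqP; split=> t /=; rewrite fstar_gt.
Qed.

(** The measure of a joint superlevel set never exceeds the smaller of the two separate measures;
    the hypothesis on [f] and [h] says that they reach this bound. Since [1 <= c], the factor [c]
    may stand before the minimum although only [v] brings it in. *)
Lemma comonotone_le f h u v (c : R) : (1 <= c)%R ->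
  Mplus f -> Mplus h -> Mplus u -> Mplus v ->
  (forall l m : R, (0 < l)%R -> (0 < m)%R -> mine (distr f l) (distr h m) <=
     mu (I01 `&` [set x | l%:E < f x /\ m%:E < h x])) ->
  (forall l, (0 < l)%R -> distr u l <= distr f l) ->
  (forall m, (0 < m)%R -> distr v m <= c%:E * distr h m) ->
  \int[mu]_(x in I01) (u x * v x) <= c%:E * \int[mu]_(x in I01) (f x * h x).
Proof.
move=> c1 Mf Mh Mu Mv H uf vh; have c0 : (0 <= c)%R := le_trans ler01 c1.
apply: layer_cake_le => // l m l0 m0.
have mA : measurable (I01 `&` [set x | l%:E < u x /\ m%:E < v x]).
  have -> : I01 `&` [set x | l%:E < u x /\ m%:E < v x] =
      (I01 `&` [set x | l%:E < u x]) `&` (I01 `&` [set x | m%:E < v x]).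
    by apply/seteqP; split => [x [? []]|x [[? ?] []]].
  by apply: measurableI; exact: measurable_superlevel.
apply: (@le_trans _ _ (c%:E * mine (distr f l) (distr h m))); last first.
  by apply: lee_wpmul2l; [rewrite lee_fin|exact: H].
have ul : mu (I01 `&` [set x | l%:E < u x /\ m%:E < v x]) <= distr u l.
  by rewrite distrE; apply: le_mu => //; [exact: measurable_superlevel|move=> x [? []]].
have vm : mu (I01 `&` [set x | l%:E < u x /\ m%:E < v x]) <= distr v m.
  by rewrite distrE; apply: le_mu => //; [exact: measurable_superlevel|move=> x [? []]].
have [_|_] := leP (distr f l) (distr h m); last exact: le_trans vm (vh _ m0).
apply: (le_trans ul); apply: (le_trans (uf _ l0)).
by apply: lee_pemull; [exact: distr_ge0|rewrite lee_fin].
Qed.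

(** This contains the Hardy-Littlewood inequality. Superlevel sets of nonincreasing functions are
    initial segments of $(0,1)$, so one of any two contains the other. *)
Lemma nincr01_le f k u v : nincr01 f -> nincr01 k ->
  Mplus f -> Mplus k -> Mplus u -> Mplus v ->
  (forall l, (0 < l)%R -> distr u l <= distr f l) ->
  (forall m, (0 < m)%R -> distr v m <= distr k m) ->
  \int[mu]_(x in I01) (u x * v x) <= \int[mu]_(x in I01) (f x * k x).
Proof.
move=> nf nk Mf Mk Mu Mv uf vk; rewrite -[leRHS]mul1e.
apply: comonotone_le => //; last by move=> m m0; rewrite mul1e; exact: vk.
move=> l m l0 m0.
pose A := I01 `&` [set x | l%:E < f x]; pose B := I01 `&` [set x | m%:E < k x].
have AB : A `<=` B \/ B `<=` A.
  have [|/existsNP[x /not_implyP[[x01 /= lx] kx]]] := pselect (A `<=` B); first by left.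
  right=> y [y01 /= my]; split=> //=; apply: (lt_le_trans lx); apply: nf => //.
  rewrite leNgt; apply/negP => xy; apply: kx; split=> //=.
  by apply: (lt_le_trans my); apply: nk => //; exact: ltW.
have -> : I01 `&` [set x | l%:E < f x /\ m%:E < k x] = A `&` B.
  by apply/seteqP; split => [x [? []]|x [[? ?] []]].
by case: AB => [/setIidl ->|/setIidr ->]; rewrite ge_min !distrE lexx// orbT.
Qed.

End nonincreasing_rearrangement.

(** * Resonance *)

Section resonance.
Variable R : realType.
Local Notation mu := (@lebesgue_measure R).
Local Notation I01 := (@Defs.I01 R).
Implicit Types (f g h u v k : R -> \bar R).
Local Hint Resolve measurable_I01 : core.

Lemma cvg_ge_mu (A : (set R)^nat) (t : \bar R) : (forall n, measurable (A n)) ->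
  (forall n, A n `<=` I01) ->
  {homo A : n m / (n <= m)%N >-> m `<=` n} -> (forall n, t <= mu (A n)) ->
  t <= mu (\bigcap_n A n).
Proof.
move=> mA A01 niA At.
have /cvg_lim cA : mu \o A @ \oo --> mu (\bigcap_n A n).
  apply: nonincreasing_cvg_mu => [|//| |n m nm]; last exact/subsetPset/niA.
  - apply: (@le_lt_trans _ _ (mu I01)); first exact: le_mu.
    by rewrite mu_I01 ltry.
  - by apply: bigcap_measurable => // n _; exact: mA.
rewrite -cA//; apply: lime_ge; last by apply: nearW => n; exact: At.
apply: ereal_nonincreasing_is_cvgn => n m nm.
by apply: le_mu => //; exact: niA.
Qed.

(** For every level below $h^*(c)$ the superlevel set has measure above [c]; continuity from above
    passes this to the intersection of these sets. *)
Lemma mu_ge_fstar h (c : R) : Mplus h -> (0 <= c <= 1)%R ->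
  c%:E <= mu (I01 `&` [set y | fstar h c <= h y]).
Proof.
move=> Mh /andP[c0 c1]; set a := fstar h c.
(* Any nonnegative sequence of levels that increases to [a] strictly from below suffices; the choice
   depends on whether [a] is finite or [+oo]. For [a = 0] there is none, but then the set is all of
   $(0,1)$. *)
have key (l : nat -> R) : (forall n, 0 <= l n)%R -> {homo l : n m / (n <= m)%N >-> (n <= m)%R} ->
    (forall n, (l n)%:E < a) -> (forall y, (forall n, (l n)%:E < y) -> a <= y) ->
    c%:E <= mu (I01 `&` [set y | a <= h y]).
  move=> l0 ndl la al; pose A n := I01 `&` [set y | (l n)%:E < h y].
  have -> : I01 `&` [set y | a <= h y] = \bigcap_n A n.
    apply/seteqP; split => [x [x01 /= ax] n _|x Ax].
      by split=> //=; exact: lt_le_trans ax.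
    split; first by have [] := Ax 0%N I.
    by apply: al => n; have [] := Ax n I.
  apply: cvg_ge_mu => [n|n x []//|n m nm x [x01 /= mx]|n].
  - exact: measurable_superlevel.
  - by split=> //=; apply: le_lt_trans mx; rewrite lee_fin ndl.
  - by rewrite -distrE ltW// -fstar_gt.
have : 0 <= a by exact: fstar_ge0.
rewrite le_eqVlt => /predU1P[a0|a0].
  have -> : I01 `&` [set y | a <= h y] = I01; last by rewrite mu_I01 lee_fin.
  by apply/seteqP; split => [x []//|x x01]; split=> //=; rewrite -a0 Mplus_ge0.
case: a a0 key => [a a0 key| _ key|//].
- rewrite lte_fin in a0.
  apply: (key (fun n => a * (1 - n.+1%:R^-1))%R) => [n|n m nm|n|y H].
  + by rewrite mulr_ge0 ?(ltW a0)// subr_ge0 invf_le1// ler1n.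
  + by rewrite ler_pM2l// lerB// lef_pV2 ?posrE// ler_nat.
  + by rewrite lte_fin gtr_pMr// ltrBlDr ltrDl.
  + case: y H => [y H|_|/(_ 0%N)//]; last by rewrite leey.
    rewrite leNgt; apply/negP; rewrite lte_fin => ya.
    have [|n nay] := @exists_harmonic_lt _ ((a - y) / a)%R.
      by rewrite divr_gt0// subr_gt0.
    have := H n; rewrite lte_fin mulrBr mulr1 => Hn.
    have : (a * n.+1%:R^-1 < a - y)%R by rewrite mulrC -ltr_pdivlMr.
    by move=> H'; have := ltrD Hn H'; rewrite subrK addrCA subrr addr0 ltxx.
- apply: (key (fun n => n%:R)) => [n|n m nm|n|y H].
  + by [].
  + by rewrite ler_nat.
  + by rewrite ltry.
  + rewrite leye_eq; case: y H => [y H|//|/(_ 0%N)//].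
    by have := H (Num.truncn y).+1; rewrite lte_fin ltNge (ltW (truncnS_gt _)).
Qed.

(** [y] precedes or equals [x] in the order by decreasing values of [h], with ties broken by
    position. *)
Definition rank_le h (x y : R) : bool := (h x < h y) || ((h x <= h y) && (y <= x)%R).

Lemma rank_le_total h x y : rank_le h x y || rank_le h y x.
Proof.
by rewrite /rank_le; case: (ltgtP (h x) (h y)) => //= _; exact: le_total.
Qed.

(** With $a = h^*(c)$, the set where $h > a$ has measure at most [c] and the set where $h \ge a$ has
    measure at least [c]. The plateau at height [a] is added from left to right until the measure is
    exactly [c]. *)
Lemma exists_initial_segment h (c : R) : Mplus h -> (0 <= c <= 1)%R ->
  exists L : set R, [/\ measurable L, L `<=` I01, mu L = c%:E &
    forall x y, L x -> I01 y -> rank_le h x y -> L y].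
Proof.
move=> Mh c01; set a := fstar h c.
pose L t := I01 `&` [set y : R | a < h y \/ (a <= h y /\ (y <= t)%R)].
have mL t : measurable (L t).
  have -> : L t = (I01 `&` [set y | a < h y]) `|`
                  ((I01 `&` [set y | a <= h y]) `&` `]-oo, t]%classic).
    apply/seteqP; split => [y [y01 [|[]]]|y [[y01] ay|[[y01 /= ay]]]] /=.
    - by left.
    - by move=> ay yt; right; split=> //; rewrite in_itv.
    - by split=> //; left.
    - by rewrite in_itv/= => yt; split=> //; right.
  apply: measurableU; first exact: measurable_superlevel.
  apply: measurableI => //; apply: measurable_lee; [exact: measurable_I01|exact: measurable_cst|exact: Mplus_measurable].
have L01 t : L t `<=` I01 by move=> y [].
have Lle1 t : mu (L t) <= 1 by rewrite -(mu_I01 R); exact: le_mu.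
have Lfin t : mu (L t) \is a fin_num.
  by rewrite ge0_fin_numE// (le_lt_trans (Lle1 t))// ltry.
pose phi t := fine (mu (L t)).
have phiE t : (phi t)%:E = mu (L t) by rewrite fineK.
have ndphi s t : (s <= t)%R -> (phi s <= phi t)%R.
  move=> st; rewrite -lee_fin !phiE; apply: le_mu => // y [y01 /=].
  by move=> [ay|[ay ys]]; split=> //=; [left|right; split=> //; exact: le_trans st].
have lip s t : (s <= t)%R -> (phi t <= phi s + (t - s))%R.
  move=> st; rewrite -lee_fin EFinD !phiE.
  (* From [s] to [t] the segment gains only points of the interval between them, so its measure is
     1-Lipschitz in the cut and the intermediate value theorem applies. *)
  have -> : (t - s)%:E = mu `]s, t]%classic.
    rewrite lebesgue_measure_itv/= lte_fin; case: ltP => [_|ts]; first by rewrite EFinB.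
    by have -> : s = t; [apply/eqP; rewrite eq_le st ts|rewrite subrr].
  apply: (@le_trans _ _ (mu (L s `|` `]s, t]%classic))); last first.
    by apply: measureU2; [exact: mL|exact: measurable_itv].
  apply: le_mu; [exact: mL|by apply: measurableU; [exact: mL|exact: measurable_itv]|].
  move=> y [y01 /= [ay|[ay yt]]]; first by left; split=> //=; left.
  have [ys|sy] := leP y s; first by left; split=> //=; right.
  by right; rewrite /= in_itv/= sy.
have cphi : {within `[0%R, 1%R], continuous phi}.
  apply: continuous_subspaceT => t; apply/cvgrPdist_le => e e0.
  near=> s; have : (`|t - s| <= e)%R by near: s; exact: cvgr_dist_le.
  move=> ts.
  have [st|ts'] := leP s t.
    rewrite ger0_norm ?subr_ge0 ?ndphi//; have := lip _ _ st.
    by move: ts; rewrite ger0_norm ?subr_ge0//; lra.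
  rewrite ler0_norm ?subr_le0 ?ndphi ?(ltW ts')//; have := lip _ _ (ltW ts').
  by move: ts; rewrite ler0_norm ?subr_le0 ?(ltW ts')//; lra.
have [|t _ phit] := @IVT _ phi 0%R 1%R c ler01 cphi.
  have /andP[c0 _] := c01.
  rewrite ge_min le_max; apply/andP; split; apply/orP; [left|right].
    rewrite -lee_fin phiE.
    have -> : L 0%R = I01 `&` [set y | a < h y].
      apply/seteqP; split => [y [y01 /= [//|[_ y0]]]|y [y01 ay]]; last by split=> //; left.
      by move: y01; rewrite I01P ltNge y0.
    case aE : a => [r| |].
    - have r0 : (0 <= r)%R by rewrite -lee_fin -aE; exact: fstar_ge0.
      by rewrite -distrE leNgt -fstar_gt// -/a aE ltxx.
    - by rewrite [X in mu X](_ : _ = set0) ?measure0 ?lee_fin//; apply/seteqP; split=> y // [_] /=; rewrite ltNge leey.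
    - by have := fstar_ge0 h c; rewrite -/a aE.
  rewrite -lee_fin phiE.
  have -> : L 1%R = I01 `&` [set y | a <= h y]; last exact: mu_ge_fstar.
  apply/seteqP; split => [y [y01 /= [/ltW//|[]//]]|y [y01 /= ay]].
  split=> //=; right; split=> //; move: y01; rewrite I01P => /andP[_]; exact: ltW.
exists (L t); split=> //; first by rewrite -phiE phit.
move=> x y [x01 /= xL] y01 /orP[xy|/andP[xy yx]]; split=> //=.
  left; case: xL => [ax|[ax _]]; [exact: lt_trans xy|exact: le_lt_trans xy].
case: xL => [ax|[ax xt]]; [left; exact: lt_le_trans xy|right].
by split; [exact: le_trans xy|exact: le_trans xt].
Unshelve. all: by end_near. Qed.

Definition rank h (x : R) : \bar R := mu (I01 `&` [set y | rank_le h x y]).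

(** The order as a subset of the square: its sections are the sets measured by [rank], so their
    measurability and that of [rank] follow from the theory of sections. *)
Let rank_set h : set (R * R) := (I01 `*` I01) `&` [set z | rank_le h z.1 z.2].

Let measurable_rank_set h : Mplus h -> measurable (rank_set h).
Proof.
move=> Mh; have mh := Mplus_measurable Mh.
have mD : measurable (I01 `*` I01) by exact: measurableX.
suff /(_ mD [set true]) : measurable_fun (I01 `*` I01) (fun z => rank_le h z.1 z.2).
  by apply.
have m1 : measurable_fun (I01 `*` I01) (fun z => h z.1) by exact: measurable_fun_fst.
have m2 : measurable_fun (I01 `*` I01) (fun z => h z.2) by exact: measurable_fun_snd.
apply: measurable_or; first exact: measurable_fun_lte.
apply: measurable_and; first exact: measurable_fun_lee.
by apply: measurable_fun_ler; exact: measurable_funTS.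
Qed.

Let rankE h x : I01 x -> rank h x = (mu \o xsection (rank_set h)) x.
Proof.
move=> x01; rewrite /rank /xsection /=; congr (mu _); apply/seteqP; split => y /=.
  by move=> [y01 xy]; rewrite inE.
by rewrite inE => -[[_ y01] xy].
Qed.

Lemma measurable_rank h : Mplus h -> measurable_fun I01 (rank h).
Proof.
move=> Mh; have /(measurable_fun_xsection mu) := measurable_rank_set Mh.
move=> /(measurable_funS measurableT (@subsetT _ I01)).
by apply: eq_measurable_fun => x /set_mem/rankE.
Qed.

Lemma measurable_rank_le h x : Mplus h -> I01 x ->
  measurable (I01 `&` [set y | rank_le h x y]).
Proof.
move=> Mh x01; have := measurable_xsection x (measurable_rank_set Mh).
congr measurable; rewrite /xsection; apply/seteqP; split => y /=.
  by rewrite inE => -[[_ y01] xy].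
by move=> [y01 xy]; rewrite inE.
Qed.

Lemma rank_ge0 h x : 0 <= rank h x.
Proof. exact: measure_ge0. Qed.

Lemma rank_le1 h x : Mplus h -> I01 x -> rank h x <= 1.
Proof.
move=> Mh x01; rewrite -(mu_I01 R); apply: le_mu => [| |y []//].
  exact: measurable_rank_le.
exact: measurable_I01.
Qed.

(** The rank is uniformly distributed. A point outside an initial segment of measure [c] is preceded
    by the whole segment, so its rank is at least [c]; a point inside a segment of measure [d] has
    all its predecessors there, so its rank is at most [d]. *)
Lemma mu_rank_lt h (c : \bar R) : Mplus h -> 0 <= c <= 1 ->
  mu (I01 `&` [set x | rank h x < c]) = c.
Proof.
move=> Mh; case: c => [c| |]; rewrite ?leye_eq ?andbF// !lee_fin => c01.
have /andP[c0 c1] := c01.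
have mA : measurable (I01 `&` [set x | rank h x < c%:E]).
  by apply: measurable_lte; [exact: measurable_I01|exact: measurable_rank|exact: measurable_cst].
apply/eqP; rewrite eq_le; apply/andP; split.
  have [L [mL L01 Lc lowL]] := exists_initial_segment Mh c01.
  rewrite -[leRHS]Lc; apply: le_mu => // x [x01 /= xc]; apply: contrapT => Lx.
  move: xc; rewrite ltNge -Lc => /negP; apply.
  apply: le_mu => // [|y Ly]; first exact: measurable_rank_le.
  split; first exact: L01.
  have /orP[//|yx] := rank_le_total h x y.
  by exfalso; apply: Lx; exact: lowL yx.
set A := I01 `&` _ in mA *; rewrite leNgt; apply/negP => muc.
(* Points of a segment of measure [d] have rank at most [d] only in the weak sense; a [d] strictly
   below [c] gives the strict inequality that puts them into [A]. *)
have : exists2 d : R, mu A < d%:E & (0 <= d < c)%R.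
  have Afin : mu A \is a fin_num.
    by rewrite ge0_fin_numE// (lt_le_trans muc)// leey.
  have Ac : (fine (mu A) < c)%R by rewrite -lte_fin fineK.
  have A0 : (0 <= fine (mu A))%R by exact: fine_ge0.
  exists ((fine (mu A) + c) / 2)%R; last lra.
  rewrite -[ltLHS]fineK// lte_fin; lra.
move=> [d mud /andP[d0 dc]].
have d01 : (0 <= d <= 1)%R by rewrite d0 (le_trans (ltW dc)).
have [L [mL L01 Ld lowL]] := exists_initial_segment Mh d01.
move: mud; rewrite ltNge -Ld => /negP; apply; apply: le_mu => // x Lx.
have x01 := L01 _ Lx; split=> //=; apply: (@le_lt_trans _ _ d%:E); last by rewrite lte_fin.
rewrite -Ld; apply: le_mu => // [|y [y01 /= xy]]; first exact: measurable_rank_le.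
exact: lowL xy.
Qed.

(* [f'] is [fstar f] read along the ranking of the points by decreasing values
   of [h]: it has the distribution of [f] and its level sets are nested with
   those of [h]. *)
Lemma resonance f h : Mplus f -> Mplus h ->
  exists f', [/\ Mplus f', forall l, distr f' l = distr f l &
    forall c u v, (1 <= c)%R -> Mplus u -> Mplus v ->
      (forall l, (0 < l)%R -> distr u l <= distr f l) ->
      (forall m, (0 < m)%R -> distr v m <= c%:E * distr h m) ->
      \int[mu]_(x in I01) (u x * v x) <= c%:E * \int[mu]_(x in I01) (f' x * h x)].
Proof.
move=> Mf Mh; pose f' x := fstar f (fine (rank h x)).
have rfin x : I01 x -> rank h x \is a fin_num.
  by move=> x01; rewrite ge0_fin_numE ?rank_ge0// (le_lt_trans (rank_le1 Mh x01))// ltry.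
have f'gt l x : (0 <= l)%R -> I01 x -> (l%:E < f' x) = (rank h x < distr f l).
  by move=> l0 x01; rewrite fstar_gt// fineK// rfin.
have f'set l : (0 <= l)%R -> I01 `&` [set x | l%:E < f' x] =
    I01 `&` [set x | rank h x < distr f l].
  by move=> l0; apply/seteqP; split => x [x01 /= H]; split=> //=; move: H; rewrite f'gt.
have Mf' : Mplus f'.
  split=> [_|x _]; last exact: fstar_ge0.
  apply: (measurability _ (ErealGenOInfty.measurableE R)); last exact: measurable_I01.
  move=> /= _ [_ [a ->]] <-.
  have -> : f' @^-1` `]a%:E, +oo[ = [set x | a%:E < f' x].
    by apply/seteqP; split => x /=; rewrite in_itv/= andbT.
  have [a0|a0] := leP 0%R a; last by rewrite superlevel_lt0// => [|x _]; [exact: measurable_I01|exact: fstar_ge0].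
  rewrite f'set//; apply: measurable_lte; [exact: measurable_I01|exact: measurable_rank|].
  exact: measurable_cst.
have distr01 g l : Mplus g -> 0 <= distr g l <= 1.
  by move=> Mg; rewrite distr_ge0 distr_le1.
have distrf' l : distr f' l = distr f l.
  have [l0|l0] := leP 0%R l; last by rewrite !distrE !superlevel_lt0//; exact: Mplus_ge0.
  by rewrite distrE f'set// mu_rank_lt//; exact: distr01.
exists f'; split=> // c u v c1 Mu Mv uf vh.
apply: comonotone_le => // [l m l0 m0|l l0]; last by rewrite distrf'; exact: uf.
rewrite distrf'.
have mm : 0 <= mine (distr f l) (distr h m) <= 1.
  by have [_|_] := leP (distr f l) (distr h m); exact: distr01.
(* Points with rank below both distribution values lie in both superlevel sets. For [f'] this is
   [f'gt]; if [h x <= m], every point where [h] exceeds [m] precedes [x], and the rank of [x] is at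
   least [distr h m]. *)
rewrite -[leLHS](mu_rank_lt Mh mm); apply: le_mu.
- by apply: measurable_lte; [exact: measurable_I01|exact: measurable_rank|exact: measurable_cst].
- have -> : I01 `&` [set x | l%:E < f' x /\ m%:E < h x] =
      (I01 `&` [set x | l%:E < f' x]) `&` (I01 `&` [set x | m%:E < h x]).
    by apply/seteqP; split => [x [? []]|x [[? ?] []]].
  by apply: measurableI; exact: measurable_superlevel.
- move=> x [x01 /=]; rewrite lt_min => /andP[xl xm]; split=> //=.
  rewrite f'gt ?(ltW l0)//; split=> //; rewrite ltNge; apply/negP => hx.
  move: xm; rewrite ltNge => /negP; apply; rewrite distrE; apply: le_mu.
  + exact: measurable_superlevel.
  + exact: measurable_rank_le.
  + by move=> y [y01 /= my]; split=> //=; rewrite /rank_le (le_lt_trans hx my).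
Qed.

End resonance.

(** * The operators *)

Section operators.
Variable R : realType.
Local Notation mu := (@lebesgue_measure R).
Local Notation I01 := (@Defs.I01 R).
Implicit Types (f g h u v k w : R -> \bar R).
Local Hint Resolve measurable_I01 : core.

Lemma subset_itv0_I01 (t : R) : I01 t -> `]0%R, t[ `<=` I01.
Proof.
rewrite I01P => /andP[_ t1] s /=; rewrite in_itv/= I01P => /andP[-> st] /=.
exact: lt_trans t1.
Qed.

Lemma subset_itv1_I01 (s : R) : I01 s -> `]s, 1%R[ `<=` I01.
Proof.
rewrite I01P => /andP[s0 _] t /=; rewrite in_itv/= I01P => /andP[st ->].
by rewrite (lt_trans s0 st).
Qed.

Lemma integral_itv0 f (t : R) : I01 t ->
  \int[mu]_(s in `]0%R, t[) f s = \int[mu]_(s in I01) (if (s < t)%R then f s else 0).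
Proof.
move=> t01.
have -> : `]0%R, t[%classic = I01 `&` [set s | (s < t)%R].
  apply/seteqP; split=> [s ts|s [/= s01 st]].
    by split; [exact: subset_itv0_I01 ts|move: ts; rewrite /= in_itv/= => /andP[]].
  by rewrite /= in_itv/= st andbT; move: s01; rewrite I01P => /andP[].
rewrite integral_mkcondr; apply: eq_integral => s _.
by rewrite /patch; case: ifPn => [/set_mem/= ->//|]; rewrite notin_setE /= => /negP/negbTE ->.
Qed.

Lemma integral_itv1 f (s : R) : I01 s ->
  \int[mu]_(t in `]s, 1%R[) f t = \int[mu]_(t in I01) (if (s < t)%R then f t else 0).
Proof.
move=> s01.
have -> : `]s, 1%R[%classic = I01 `&` [set t | (s < t)%R].
  apply/seteqP; split=> [t ts|t [/= t01 st]].
    by split; [exact: subset_itv1_I01 ts|move: ts; rewrite /= in_itv/= => /andP[]].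
  by rewrite /= in_itv/= st; move: t01; rewrite I01P => /andP[].
rewrite integral_mkcondr; apply: eq_integral => t _.
by rewrite /patch; case: ifPn => [/set_mem/= ->//|]; rewrite notin_setE /= => /negP/negbTE ->.
Qed.

Let K f w (s t : R) : \bar R := if (s < t)%R then f s * w t else 0.

Let measurable_K f w : Mplus f -> Mplus w ->
  measurable_fun (I01 `*` I01) (fun z => K f w z.1 z.2).
Proof.
move=> [mf _] [mw _]; have mX : measurable (I01 `*` I01) by exact: measurableX.
apply: measurable_fun_if => //.
  by apply: measurable_fun_ltr; exact: measurable_funTS.
apply: (measurable_funS mX); first exact: subIsetl.
by apply: emeasurable_funM; [exact: measurable_fun_fst|exact: measurable_fun_snd].
Qed.

Let K_ge0 f w s t : Mplus f -> Mplus w -> I01 s -> I01 t -> 0 <= K f w s t.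
Proof.
move=> Mf Mw s01 t01; rewrite /K; case: ifP => // _.
by rewrite mule_ge0//; exact: Mplus_ge0.
Qed.

Let integral_K1 f w t : Mplus f -> Mplus w -> I01 t ->
  \int[mu]_(s in I01) K f w s t = w t * \int[mu]_(s in `]0%R, t[) f s.
Proof.
move=> [mf f0] Mw t01; rewrite -ge0_integralZl//; last 3 first.
- exact: (measurable_funS (@measurable_I01 R) (subset_itv0_I01 t01) mf).
- by move=> s /(subset_itv0_I01 t01); exact: f0.
- exact: Mplus_ge0.
rewrite (integral_itv0 (fun s => w t * f s) t01); apply: eq_integral => s _.
by rewrite /K; case: ifP => // _; rewrite muleC.
Qed.

Let integral_K2 f w s : Mplus f -> Mplus w -> I01 s ->
  \int[mu]_(t in I01) K f w s t = f s * \int[mu]_(t in `]s, 1%R[) w t.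
Proof.
move=> Mf [mw w0] s01; rewrite -ge0_integralZl//; last 3 first.
- exact: (measurable_funS (@measurable_I01 R) (subset_itv1_I01 s01) mw).
- by move=> t /(subset_itv1_I01 s01); exact: w0.
- exact: Mplus_ge0.
by rewrite (integral_itv1 (fun t => f s * w t) s01).
Qed.

(** Both sides integrate [f s * w t] over the triangle $0 < s < t < 1$. *)
Lemma integral_triangle f w : Mplus f -> Mplus w ->
  \int[mu]_(t in I01) (w t * \int[mu]_(s in `]0%R, t[) f s) =
  \int[mu]_(s in I01) (f s * \int[mu]_(t in `]s, 1%R[) w t).
Proof.
move=> Mf Mw.
transitivity (\int[mu]_(t in I01) \int[mu]_(s in I01) K f w s t).
  by apply: eq_integral => t /set_mem t01; rewrite integral_K1.
rewrite -tonelli_on//; last 2 first.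
- exact: measurable_K.
- by move=> s t; exact: K_ge0.
by apply: eq_integral => s /set_mem s01; rewrite integral_K2.
Qed.

Lemma Mplus_triangle f w : Mplus f -> Mplus w ->
  Mplus (fun t => w t * \int[mu]_(s in `]0%R, t[) f s).
Proof.
move=> Mf Mw; split=> [|t t01]; last first.
  rewrite mule_ge0//; first exact: Mplus_ge0.
  by apply: integral_ge0 => s /(subset_itv0_I01 t01); exact: Mplus_ge0.
have : measurable_fun I01 (fun t => \int[mu]_(s in I01) K f w s t).
  apply: measurable_inner_integral => //; first exact: measurable_K.
  by move=> s t; exact: K_ge0.
by apply: eq_measurable_fun => t /set_mem t01; rewrite integral_K1.
Qed.

(** * Averages, $H_I$ and $S_I$ for a quasiconcave $I$ *)

Section quasiconcave.
Variables (I : R -> R) (qI : quasiconcave I).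

Lemma qc_homo s t : I01 s -> I01 t -> (s <= t)%R -> (I s <= I t)%R.
Proof. by move=> s01 t01; have [H _] := qI; apply: H; rewrite inE. Qed.

Lemma qc_I01 t : I01 t -> I01 (I t).
Proof. by have [_ [H _]] := qI; exact: H. Qed.

Lemma qc_gt0 t : I01 t -> (0 < I t)%R.
Proof. by move=> /qc_I01; rewrite I01P => /andP[]. Qed.

Lemma qc_lt1 t : I01 t -> (I t < 1)%R.
Proof. by move=> /qc_I01; rewrite I01P => /andP[]. Qed.

(** If $q = I(t)/t < 1$, then $I \le q$ everywhere: to the left of $t$ because $I(s) \le I(t) \le
    q$, to the right because $I(s) \le I(s)/s \le q$. So the midpoint [y] of $q$ and 1 is not
    attained, against surjectivity. *)
Lemma qc_ge_id t : I01 t -> (t <= I t)%R.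
Proof.
move=> t01; have := t01; rewrite I01P => /andP[t0 t1]; rewrite leNgt; apply/negP => It.
have It0 := qc_gt0 t01.
pose y := ((I t / t + 1) / 2)%R.
have q1 : (I t / t < 1)%R by rewrite ltr_pdivrMr// mul1r.
have q0 : (0 < I t / t)%R by rewrite divr_gt0.
have [_ [_ [_ [surj [_ [_ qI']]]]]] := qI.
have [|s s01 sy] := surj y; first by rewrite I01P /y; lra.
have s1 : (0 < s < 1)%R by rewrite -I01P.
have [st|ts] := leP s t.
  have : (I s <= I t)%R by exact: qc_homo.
  have : (I t <= I t / t)%R by rewrite ler_pdivlMr// ler_piMr// ltW.
  by rewrite sy /y; lra.
have := qI' t s t01 s01 (ltW ts).
have : (I s <= I s / s)%R.
  have /andP[s0 s1'] := s1; have Is0 := qc_gt0 s01.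
  by rewrite ler_pdivlMr// ler_piMr// ltW.
by rewrite sy /y; lra.
Qed.

Lemma Mplus_invI : Mplus (fun t => ((I t)^-1)%:E).
Proof.
apply: Mplus_nincr01 => [s t s01 t01 st|t t01].
  by rewrite lee_fin lef_pV2 ?posrE ?qc_gt0// qc_homo.
by rewrite lee_fin invr_ge0 ltW// qc_gt0.
Qed.

Lemma avgI_ge0 f t : I01 t -> 0 <= avgI I f t.
Proof.
move=> t01; rewrite mule_ge0 ?lee_fin ?invr_ge0 ?(ltW (qc_gt0 _))//.
by apply: integral_ge0 => s _; exact: fstar_ge0.
Qed.

Lemma Mplus_avgI f : Mplus (avgI I f).
Proof. exact: (Mplus_triangle (Mplus_fstar f) Mplus_invI). Qed.

Lemma integral_avgI f g : Mplus g ->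
  \int[mu]_(t in I01) (g t * avgI I f t) = \int[mu]_(s in I01) (fstar f s * H_I I g s).
Proof.
move=> Mg; have := integral_triangle (Mplus_fstar f) (MplusM Mg Mplus_invI).
move=> <-; apply: eq_integral => t _; exact: muleA.
Qed.

Lemma nincr01_H_I g : Mplus g -> nincr01 (H_I I g).
Proof.
move=> Mg s t s01 t01 st; have [mw w0] := MplusM Mg Mplus_invI.
apply: ge0_subset_integral => //.
- exact: (measurable_funS (@measurable_I01 R) (subset_itv1_I01 s01) mw).
- by move=> x /(subset_itv1_I01 s01); exact: w0.
- move=> x /=; rewrite !in_itv/= => /andP[tx ->]; rewrite andbT.
  exact: le_lt_trans tx.
Qed.

Lemma Mplus_H_I g : Mplus g -> Mplus (H_I I g).
Proof.
move=> Mg; apply: Mplus_nincr01; first exact: nincr01_H_I.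
move=> s s01; have [_ w0] := MplusM Mg Mplus_invI.
by apply: integral_ge0 => x /(subset_itv1_I01 s01); exact: w0.
Qed.

Lemma fstar_le_S_I f t : I01 t -> fstar f t <= S_I I f t.
Proof.
move=> t01; have It0 := qc_gt0 t01.
rewrite /S_I; apply: (@le_trans _ _ (((I t)^-1)%:E * ((I t)%:E * fstar f t))).
  by rewrite muleA -EFinM mulVf ?gt_eqF// mul1e.
rewrite lee_wpmul2l ?lee_fin ?invr_ge0 ?(ltW It0)//; apply: ereal_sup_ubound.
by exists t => //=; rewrite in_itv/= lexx andbT; move: t01; rewrite I01P => /andP[].
Qed.

Lemma S_I_ge0 f t : I01 t -> 0 <= S_I I f t.
Proof. by move=> t01; apply: le_trans (fstar_le_S_I f t01); exact: fstar_ge0. Qed.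

Lemma itv_oc_I01 (s t : R) : I01 t -> `]0%R, t]%classic s -> I01 s.
Proof.
rewrite !I01P => /andP[_ t1] /=; rewrite in_itv/= => /andP[-> st] /=.
exact: le_lt_trans t1.
Qed.

Lemma S_I_le f t (y : \bar R) : I01 t ->
  (forall s, I01 s -> (s <= t)%R -> (I s)%:E * fstar f s <= (I t)%:E * y) ->
  S_I I f t <= y.
Proof.
move=> t01 H; have It0 := qc_gt0 t01.
rewrite /S_I; apply: (@le_trans _ _ (((I t)^-1)%:E * ((I t)%:E * y))); last first.
  by rewrite muleA -EFinM mulVf ?gt_eqF// mul1e.
rewrite lee_wpmul2l ?lee_fin ?invr_ge0 ?(ltW It0)//; apply: ge_ereal_sup.
move=> _ [s st <-]; apply: H; first exact: itv_oc_I01 st.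
by move: st; rewrite /= in_itv/= => /andP[].
Qed.

Lemma le_S_I f s t : I01 s -> I01 t -> (s <= t)%R ->
  (I s)%:E * fstar f s <= (I t)%:E * S_I I f t.
Proof.
move=> s01 t01 st; have It0 := qc_gt0 t01.
rewrite /S_I muleA -EFinM mulfV ?gt_eqF// mul1e; apply: ereal_sup_ubound.
by exists s => //=; rewrite in_itv/= st andbT; move: s01; rewrite I01P => /andP[].
Qed.

(** The supremum in [S_I] grows with its range, so only the new points between [t1] and [t2] need an
    argument: there $I(s) f^*(s) \le I(t_2) f^*(t_1)$, and $f^*(t_1) \le S_I f(t_1)$. *)
Lemma nincr01_S_I f : nincr01 (S_I I f).
Proof.
move=> t1 t2 t101 t201 t12; apply: S_I_le => // s s01 st2.
have [st1|t1s] := leP s t1.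
  apply: (le_trans (le_S_I f s01 t101 st1)).
  by apply: lee_wpmul2r; [exact: S_I_ge0|rewrite lee_fin qc_homo].
apply: (@le_trans _ _ ((I s)%:E * fstar f t1)).
  apply: lee_wpmul2l; first by rewrite lee_fin ltW// qc_gt0.
  by apply: fstar_nincr; exact: ltW.
apply: (@le_trans _ _ ((I t2)%:E * fstar f t1)).
  by apply: lee_wpmul2r; [exact: fstar_ge0|rewrite lee_fin qc_homo].
apply: lee_wpmul2l; first by rewrite lee_fin ltW// qc_gt0.
exact: fstar_le_S_I.
Qed.

Lemma Mplus_S_I f : Mplus (S_I I f).
Proof. by apply: Mplus_nincr01; [exact: nincr01_S_I|exact: S_I_ge0]. Qed.

(** The set where [k] exceeds [k t] lies to the left of [t]. Equality may fail at a jump, since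
    [fstar] is right continuous. *)
Lemma fstar_le_nincr01 k t : nincr01 k -> Mplus k -> I01 t -> fstar k t <= k t.
Proof.
move=> nk Mk t01; have t0 : (0 < t)%R by move: t01; rewrite I01P => /andP[].
have := Mplus_ge0 Mk t01.
case kt : (k t) => [y| |]; [|by move=> *; exact: leey|by []].
rewrite lee_fin => y0; rewrite leNgt fstar_gt// -leNgt.
have -> : t%:E = mu `]0%R, t]%classic.
  by rewrite lebesgue_measure_itv/= lte_fin t0 oppr0 adde0.
rewrite distrE; apply: le_mu; [exact: measurable_superlevel|exact: measurable_itv|].
move=> s [s01 /= ys]; rewrite in_itv/=; have := s01; rewrite I01P => /andP[-> _] /=.
rewrite leNgt; apply: contraTN ys => ts; rewrite -leNgt -kt.
by apply: nk => //; exact: ltW.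
Qed.

(** Being nonincreasing, $S_I f$ dominates its rearrangement, and $I(s) S_I f(s)$ is a supremum over
    a range that grows with $s$. *)
Lemma S_I_idem_le f t : I01 t -> S_I I (S_I I f) t <= S_I I f t.
Proof.
move=> t01; apply: S_I_le => // s s01 st.
apply: (@le_trans _ _ ((I s)%:E * S_I I f s)).
  apply: lee_wpmul2l; first by rewrite lee_fin ltW// qc_gt0.
  by apply: fstar_le_nincr01 => //; [exact: nincr01_S_I|exact: Mplus_S_I].
have Is0 := qc_gt0 s01.
rewrite /S_I muleA -EFinM mulfV ?gt_eqF// mul1e.
rewrite muleA -EFinM mulfV ?gt_eqF ?qc_gt0// mul1e.
apply: le_ereal_sup => _ [r rs <-]; exists r => //=.
move: rs; rewrite /= !in_itv/= => /andP[->] /= rs; exact: le_trans st.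
Qed.

(** The mean of $f^*$ over $(0,t)$ decreases in $t$: the value $m = f^*(y)$ lies below $f^*$ on
    $(0,y)$ and above it on $[y,r)$. *)
Lemma integral_fstar_concave f (y r : R) : (0 < y < r)%R -> (r < 1)%R ->
  y%:E * \int[mu]_(s in `]0%R, r[) fstar f s <= r%:E * \int[mu]_(s in `]0%R, y[) fstar f s.
Proof.
move=> /andP[y0 yr] r1.
pose F t := \int[mu]_(s in `]0%R, t[) fstar f s.
have mf : forall D, D `<=` I01 -> measurable D -> measurable_fun D (fstar f).
  by move=> D D01 mD; exact: (measurable_funS (@measurable_I01 R) D01 (Mplus_measurable (Mplus_fstar f))).
pose m := fstar f y.
have Fy : y%:E * m <= F y.
  have -> : y%:E * m = \int[mu]_(s in `]0%R, y[) m.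
    transitivity (m * mu `]0%R, y[%classic); last by rewrite integral_cst.
    by rewrite lebesgue_measure_itv/= lte_fin y0 oppr0 adde0 muleC.
  apply: ge0_le_integral => //.
  - by move=> s _; exact: fstar_ge0.
  - apply: mf => // s /=; rewrite in_itv/= I01P => /andP[-> sy] /=.
    by apply: lt_trans (lt_trans sy yr) r1.
  - by move=> s /=; rewrite in_itv/= => /andP[_ /ltW]; exact: fstar_nincr.
have FrE : F r = F y + \int[mu]_(s in `[y, r[) fstar f s.
  rewrite /F -ge0_integral_setU//; first last.
  - apply/disj_setPS => s [/=]; rewrite !in_itv/= => /andP[_ sy] /andP[ys _].
    by move: sy; rewrite ltNge ys.
  - by move=> s _; exact: fstar_ge0.
  - apply: mf; last exact: measurableU.
    move=> s /= []; rewrite in_itv/= I01P => /andP[s0 s1].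
      by rewrite s0 (lt_trans s1 (lt_trans yr r1)).
    by rewrite (lt_le_trans y0 s0) (lt_trans s1 r1).
  congr integral; apply/seteqP; split => s /=; rewrite !in_itv/=.
    by move=> /andP[s0 sr]; rewrite s0 sr/= andbT; case: (ltP s y); [left|right].
  move=> [/andP[-> sy]|/andP[ys ->]]; first by rewrite (lt_trans sy yr).
  by rewrite (lt_le_trans y0 ys).
have Frest : \int[mu]_(s in `[y, r[) fstar f s <= (r - y)%:E * m.
  have -> : (r - y)%:E * m = \int[mu]_(s in `[y, r[) m.
    transitivity (m * mu `[y, r[%classic); last by rewrite integral_cst.
    by rewrite lebesgue_measure_itv/= lte_fin yr muleC EFinB.
  apply: ge0_le_integral => //.
  - by move=> s _; exact: fstar_ge0.
  - apply: mf => // s /=; rewrite in_itv/= I01P => /andP[ys sr] /=.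
    by rewrite (lt_le_trans y0 ys) (lt_trans sr r1).
  - by move=> s /=; rewrite in_itv/= => /andP[ys _]; exact: fstar_nincr.
rewrite -/(F r) -/(F y) FrE.
have F0 : 0 <= F y by apply: integral_ge0 => s _; exact: fstar_ge0.
have m0 : 0 <= m by exact: fstar_ge0.
have Fr0 : 0 <= \int[mu]_(s in `[y, r[) fstar f s.
  by apply: integral_ge0 => s _; exact: fstar_ge0.
rewrite muleDr ?ge0_adde_def ?inE//.
have -> : r%:E * F y = y%:E * F y + (r - y)%:E * F y.
  rewrite -ge0_muleDl ?lee_fin ?(ltW y0) ?subr_ge0 ?(ltW yr)//.
  by rewrite -EFinD addrCA subrr addr0.
apply: leeD2l; apply: (@le_trans _ _ (y%:E * ((r - y)%:E * m))).
  by rewrite lee_wpmul2l// lee_fin ltW.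
rewrite muleCA lee_wpmul2l// lee_fin subr_ge0; exact: ltW.
Qed.

End quasiconcave.

End operators.

(** * Associate norms *)

Section associate_norms.
Variable R : realType.
Local Notation mu := (@lebesgue_measure R).
Local Notation I01 := (@Defs.I01 R).
Implicit Types (f g h u v k w : R -> \bar R).
Implicit Type rho : (R -> \bar R) -> \bar R.
Local Hint Resolve measurable_I01 : core.

Lemma integral_le_assoc rho f g : Mplus f -> rho f <= 1 ->
  \int[mu]_(x in I01) (f x * g x) <= assoc rho g.
Proof. by move=> Mf f1; apply: ereal_sup_ubound; exists f. Qed.

Lemma assoc_le rho g (y : \bar R) :
  (forall f, Mplus f -> rho f <= 1 -> \int[mu]_(x in I01) (f x * g x) <= y) ->
  assoc rho g <= y.
Proof. by move=> H; apply: ge_ereal_sup => _ [f [Mf f1] <-]; exact: H. Qed.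

Lemma le_integral_mul f g1 g2 : Mplus f -> Mplus g1 -> Mplus g2 ->
  (forall x, I01 x -> g1 x <= g2 x) ->
  \int[mu]_(x in I01) (f x * g1 x) <= \int[mu]_(x in I01) (f x * g2 x).
Proof.
move=> Mf Mg1 Mg2 g12.
have [m1 p1] := MplusM Mf Mg1; have [m2 p2] := MplusM Mf Mg2.
apply: ge0_le_integral => //; first exact: measurable_I01.
by move=> x x01; apply: lee_wpmul2l; [exact: Mplus_ge0|exact: g12].
Qed.

Lemma le_assoc rho g1 g2 : Mplus g1 -> Mplus g2 ->
  (forall x, I01 x -> g1 x <= g2 x) -> assoc rho g1 <= assoc rho g2.
Proof.
move=> Mg1 Mg2 g12; apply: assoc_le => f Mf f1.
by apply: le_trans (integral_le_assoc _ Mf f1); exact: le_integral_mul.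
Qed.

Lemma distrZ f (a l : R) : (0 < a)%R -> distr (fun x => a%:E * f x) l = distr f (l / a).
Proof.
move=> a0; rewrite !distrE; congr (mu (_ `&` _)); apply/seteqP; split => x /=;
  by rewrite EFinM lte_pdivrMr// muleC.
Qed.

Definition rearrangement_invariant rho := forall f g, Mplus f -> Mplus g ->
  (forall l : R, distr f l = distr g l) -> rho f = rho g.

(** Dilations are bounded on an associate space: a test function [g] is replaced by a rearrangement
    [g'] aligned with [a * u], which has the same norm. The factor [c] pays for the measure, [a] for
    the height. *)
Lemma assoc_dilation rho (a c : R) u v : rearrangement_invariant rho ->
  (0 < a)%R -> (1 <= c)%R -> Mplus u -> Mplus v ->
  (forall l, (0 < l)%R -> distr v l <= c%:E * distr u (l / a)) ->
  assoc rho v <= (c * a)%:E * assoc rho u.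
Proof.
move=> ri a0 c1 Mu Mv vu; apply: assoc_le => g Mg g1.
have Mau : Mplus (fun x => a%:E * u x) by apply: MplusZ => //; exact: ltW.
have [g' [Mg' g'g H]] := resonance Mg Mau.
have := H c g v c1 Mg Mv (fun l _ => lexx _).
move=> /(_ _)/le_trans; apply; first by move=> m m0; rewrite distrZ//; exact: vu.
have [m' p'] := MplusM Mg' Mu.
have -> : \int[mu]_(x in I01) (g' x * (a%:E * u x)) =
    a%:E * \int[mu]_(x in I01) (g' x * u x).
  rewrite -integralZ//; last exact: ltW.
  by apply: eq_integral => x _; rewrite muleCA.
rewrite muleA -EFinM; apply: lee_wpmul2l.
  by rewrite lee_fin mulr_ge0 ?(ltW a0)// (le_trans ler01).
by apply: integral_le_assoc => //; rewrite (ri _ g).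
Qed.

(** * The associate norm of $S_I$ applied to averages *)

Section quasiconcave.
Variables (I : R -> R) (qI : quasiconcave I).

Lemma mul_avgI f t : I01 t ->
  (I t)%:E * avgI I f t = \int[mu]_(s in `]0%R, t[) fstar f s.
Proof.
by move=> t01; rewrite /avgI muleA -EFinM mulfV ?mul1e// gt_eqF// qc_gt0.
Qed.

Lemma le_mul_avgI f s t : I01 s -> I01 t -> (s <= t)%R ->
  (I s)%:E * avgI I f s <= (I t)%:E * avgI I f t.
Proof.
move=> s01 t01 st; rewrite !mul_avgI//; apply: ge0_subset_integral => //.
- exact: (measurable_funS (@measurable_I01 R) (subset_itv0_I01 t01)
           (Mplus_measurable (Mplus_fstar f))).
- by move=> x _; exact: fstar_ge0.
- by move=> x /=; rewrite !in_itv/= => /andP[-> xs] /=; exact: lt_le_trans st.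
Qed.

(** By contraposition. If $u \le l$ on $[t,1)$, then, as $I u$ is nondecreasing, $I(r) u(r) \le I(t)
    l$ for $r < t$; hence $u \le l I(t)/I(s)$ to the right of $s$, for every $s \le t$. This bounds
    $u^*(s)$. *)
Lemma S_I_avgI_gt f (l t : R) : (0 < l)%R -> I01 t -> l%:E < S_I I (avgI I f) t ->
  exists r, [/\ I01 r, (t <= r)%R & l%:E < avgI I f r].
Proof.
move=> l0 t01; set u := avgI I f; apply: contraPP => H; apply/negP.
rewrite -leNgt; apply: S_I_le => // s s01 st.
have ul r : I01 r -> (t <= r)%R -> u r <= l%:E.
  by move=> r01 tr; rewrite leNgt; apply/negP => lr; apply: H; exists r.
have Is0 := qc_gt0 qI s01; have It0 := qc_gt0 qI t01.
pose m := (l * I t / I s)%R.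
have lm : (l <= m)%R by rewrite /m -mulrA ler_peMr ?ler_pdivlMr ?mul1r ?qc_homo// ltW.
suff sm : fstar u s <= m%:E.
  apply: (@le_trans _ _ ((I s)%:E * m%:E)).
    by apply: lee_wpmul2l => //; rewrite lee_fin ltW.
  by rewrite -!EFinM lee_fin /m mulrC divfK ?gt_eqF// mulrC.
rewrite leNgt fstar_gt -?leNgt; [|exact: Mplus_avgI|exact: le_trans (ltW l0) lm].
have -> : s%:E = mu `]0%R, s]%classic.
  have s0 : (0 < s)%R by move: s01; rewrite I01P => /andP[].
  by rewrite lebesgue_measure_itv/= lte_fin s0 oppr0 adde0.
rewrite distrE; apply: le_mu; [|exact: measurable_itv|].
  by apply: measurable_superlevel; exact: Mplus_avgI.
move=> r [r01 /= mr]; rewrite in_itv/=; have := r01; rewrite I01P => /andP[-> _] /=.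
rewrite leNgt; apply: contraTN mr => sr; rewrite -leNgt.
have [tr|rt] := leP t r; first by rewrite (le_trans (ul _ r01 tr))// lee_fin.
have Ir0 := qc_gt0 qI r01.
have Ir : (I r)%:E * u r <= (I t * l)%:E.
  apply: (le_trans (le_mul_avgI f r01 t01 (ltW rt))).
  by rewrite EFinM; apply: lee_wpmul2l; [rewrite lee_fin ltW|exact: ul].
rewrite -(@lee_pmul2l _ (I r)%:E) ?lte_fin//; apply: (le_trans Ir).
have -> : (I r)%:E * m%:E = ((I t * l) * (I r / I s))%:E.
  by rewrite -EFinM /m; congr EFin; ring.
rewrite lee_fin ler_peMr ?(mulr_ge0 (ltW It0) (ltW l0))//.
by rewrite ler_pdivlMr// mul1r qc_homo// ltW.
Qed.

Lemma le_distr_avgI f (l r : R) : (0 < l)%R -> I01 r -> l%:E < avgI I f r ->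
  r%:E <= 2%:E * distr (avgI I f) (l / 2).
Proof.
move=> l0 r01 lr; have := r01; rewrite I01P => /andP[r0 r1].
have Ir0 := qc_gt0 qI r01.
have -> : r%:E = 2%:E * mu `[(r / 2)%R, r[%classic.
  rewrite lebesgue_measure_itv/= lte_fin ifT; last lra.
  by rewrite -EFinB -EFinM; congr EFin; lra.
apply: lee_wpmul2l; first by rewrite lee_fin.
rewrite distrE; apply: le_mu; [exact: measurable_itv| |].
  by apply: measurable_superlevel; exact: Mplus_avgI.
move=> y /=; rewrite in_itv/= => /andP[ry yr].
have y0 : (0 < y)%R by lra.
have y01 : I01 y by rewrite I01P y0 (lt_trans yr).
split=> //=; rewrite ltNge; apply/negP => yl.
have := @integral_fstar_concave _ f y r; rewrite y0 yr => /(_ isT r1).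
rewrite -(mul_avgI f y01) -(mul_avgI f r01); apply/negP; rewrite -ltNge.
(* With $F(t) = I(t) u(t)$, the assumption $u(y) \le l/2$ gives $r F(y) \le (r/2) I(r) l < (r/2)
   F(r) \le y F(r)$, against concavity. *)
apply: (@le_lt_trans _ _ ((r / 2) * (I r * l))%:E).
  have -> : (r / 2 * (I r * l) = r * (I r * (l / 2)))%R by lra.
  rewrite EFinM; apply: lee_wpmul2l; first by rewrite lee_fin ltW.
  rewrite EFinM; apply: (@le_trans _ _ ((I y)%:E * (l / 2)%:E)).
    by apply: lee_wpmul2l => //; rewrite lee_fin ltW// qc_gt0.
  by rewrite -!EFinM lee_fin ler_pM2r ?divr_gt0// qc_homo// ltW.
apply: (@lt_le_trans _ _ ((r / 2)%:E * ((I r)%:E * avgI I f r))).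
  by rewrite !EFinM lte_pmul2l ?lte_fin ?divr_gt0// lte_pmul2l ?lte_fin.
apply: lee_wpmul2r; last by rewrite lee_fin.
by rewrite mule_ge0 ?lee_fin ?(ltW Ir0)// avgI_ge0.
Qed.

(** Every [t] in the superlevel set is at most some [r] with [avgI I f r] above [l], and every such
    [r] is at most [d]; so the set lies in $(0,d]$. *)
Lemma distr_S_I_avgI f (l : R) : (0 < l)%R ->
  distr (S_I I (avgI I f)) l <= 2%:E * distr (avgI I f) (l / 2).
Proof.
move=> l0.
have fin : distr (avgI I f) (l / 2) \is a fin_num.
  rewrite ge0_fin_numE ?distr_ge0//; apply: le_lt_trans (ltry 1%R).
  by apply: distr_le1; exact: Mplus_avgI.
pose d := (2 * fine (distr (avgI I f) (l / 2)))%R.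
have dE : 2%:E * distr (avgI I f) (l / 2) = d%:E by rewrite EFinM fineK.
have d0 : (0 <= d)%R by rewrite mulr_ge0// fine_ge0// distr_ge0.
rewrite dE; have -> : d%:E = mu `]0%R, d]%classic.
  rewrite lebesgue_measure_itv/= lte_fin; case: ltP => [_|d0']; first by rewrite oppr0 adde0.
  by congr EFin; apply/eqP; rewrite eq_le d0 d0'.
rewrite distrE; apply: le_mu; [|exact: measurable_itv|].
  by apply: measurable_superlevel; exact: Mplus_S_I.
move=> t [t01 /= /(S_I_avgI_gt l0 t01)[r [r01 tr lr]]].
rewrite in_itv/=; have := t01; rewrite I01P => /andP[-> _] /=.
by apply: (le_trans tr); rewrite -lee_fin -dE; exact: le_distr_avgI.
Qed.

Lemma assoc_S_I_avgI_le rho f : rearrangement_invariant rho ->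
  assoc rho (S_I I (avgI I f)) <= 4%:E * assoc rho (avgI I f).
Proof.
(* One factor 2 comes from the measure of the superlevel set, the other from the level [l / 2]. *)
move=> ri; have -> : (4 = 2 * 2 :> R)%R by lra.
apply: assoc_dilation => //.
- by lra.
- exact: Mplus_avgI.
- exact: Mplus_S_I.
- by move=> l; exact: distr_S_I_avgI.
Qed.

(** Hardy-Littlewood replaces both functions by their rearrangements, after which $f^* \le S_I f$
    applies pointwise. *)
Lemma assoc_le_S_I rho f : rearrangement_invariant rho -> Mplus f ->
  assoc rho f <= assoc rho (S_I I f).
Proof.
move=> ri Mf; apply: assoc_le => g Mg g1.
apply: (@le_trans _ _ (\int[mu]_(x in I01) (fstar g x * fstar f x))).
  apply: nincr01_le => //; try exact: nincr01_fstar; try exact: Mplus_fstar.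
  - by move=> l _; rewrite distr_fstar.
  - by move=> l _; rewrite distr_fstar.
apply: (@le_trans _ _ (\int[mu]_(x in I01) (fstar g x * S_I I f x))).
  apply: le_integral_mul; try exact: Mplus_fstar; first exact: Mplus_S_I.
  by move=> x x01; exact: fstar_le_S_I.
apply: integral_le_assoc; first exact: Mplus_fstar.
by rewrite (ri _ g)//; [exact: Mplus_fstar|move=> l; exact: distr_fstar].
Qed.

Lemma assoc_S_I_idem_le rho f : assoc rho (S_I I (S_I I f)) <= assoc rho (S_I I f).
Proof.
apply: le_assoc; [exact: Mplus_S_I..|].
by move=> t; exact: S_I_idem_le.
Qed.

End quasiconcave.

End associate_norms.

(** * Seminorms with the Fatou property *)

Section fatou_seminorms.
Variable R : realType.
Local Notation mu := (@lebesgue_measure R).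
Local Notation I01 := (@Defs.I01 R).
Implicit Types (b f g h u v k w : R -> \bar R).
Implicit Types (rho phi : (R -> \bar R) -> \bar R).
Local Hint Resolve measurable_I01 : core.

(** These axioms of [ri_norm] pass to suprema and hold for the functionals $h \mapsto \int b h$.
    Rearrangement invariance is kept apart because a single such functional lacks it. *)
Definition fatou_seminorm rho :=
  [/\ forall f, Mplus f -> 0 <= rho f,
      forall f (a : R), Mplus f -> (0 <= a)%R ->
        rho (fun x => a%:E * f x) = a%:E * rho f,
      forall f g, Mplus f -> Mplus g -> rho (f \+ g) <= rho f + rho g,
      forall f g, Mplus f -> Mplus g ->
        {ae mu, forall x, I01 x -> g x <= f x} -> rho g <= rho f &
      forall (fn : nat -> R -> \bar R) f, (forall n, Mplus (fn n)) -> Mplus f ->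
        {ae mu, forall x, I01 x -> (forall n, fn n x <= fn n.+1 x) /\
                                    fn ^~ x @ \oo --> f x} ->
        rho \o fn @ \oo --> rho f].

Lemma ri_norm_fatou rho : ri_norm rho -> fatou_seminorm rho.
Proof. by move=> [? [? [? [? [? [? _]]]]]]. Qed.

Lemma ri_norm_invariant rho : ri_norm rho -> rearrangement_invariant rho.
Proof. by move=> [? [? [? [? [? [? [? [? ?]]]]]]]]. Qed.

Lemma ri_norm_indic rho E : ri_norm rho -> measurable E -> E `<=` I01 ->
  rho (fun x => ((\1_E x : R))%:E) < +oo.
Proof. by move=> [? [? [? [? [? [? [H _]]]]]]]; exact: H. Qed.

Lemma seminorm_ge0 rho f : fatou_seminorm rho -> Mplus f -> 0 <= rho f.
Proof. by case=> H *; exact: H. Qed.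

Lemma seminormZ rho f (a : R) : fatou_seminorm rho -> Mplus f -> (0 <= a)%R ->
  rho (fun x => a%:E * f x) = a%:E * rho f.
Proof. by case=> _ H *; exact: H. Qed.

Lemma seminormD rho f g : fatou_seminorm rho -> Mplus f -> Mplus g ->
  rho (f \+ g) <= rho f + rho g.
Proof. by case=> _ _ H *; exact: H. Qed.

Lemma seminorm_le_ae rho f g : fatou_seminorm rho -> Mplus f -> Mplus g ->
  {ae mu, forall x, I01 x -> g x <= f x} -> rho g <= rho f.
Proof. by case=> _ _ _ H _ *; exact: H. Qed.

Lemma seminorm_le rho f g : fatou_seminorm rho -> Mplus f -> Mplus g ->
  (forall x, I01 x -> g x <= f x) -> rho g <= rho f.
Proof. by move=> s Mf Mg gf; apply: seminorm_le_ae => //; exact: aeW. Qed.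

(** Almost everywhere [f] is at most [0 * f], and the norm of the latter is [0 * rho f], which is 0
    by convention even for an infinite [rho f]. *)
Lemma seminorm_ae_zero rho f : fatou_seminorm rho -> Mplus f -> ae_zero f -> rho f = 0.
Proof.
move=> s Mf f0; apply/eqP; rewrite eq_le seminorm_ge0// andbT.
have M0 := MplusZ (lexx 0%R) Mf.
rewrite -(mul0e (rho f)) -(seminormZ s Mf (lexx _)); apply: seminorm_le_ae => //.
apply: negligibleS f0 => x /= /not_implyP[x01 fx]; split=> //=.
by apply/eqP => fx0; apply: fx; rewrite mul0e fx0.
Qed.

Lemma integral_eq0_ae f : Mplus f -> \int[mu]_(x in I01) f x = 0 -> ae_zero f.
Proof.
move=> [mf f0] int0.
have /(ae_eq_integral_abs mu (@measurable_I01 R) mf) : \int[mu]_(x in I01) `|f x| = 0.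
  by rewrite -int0; apply: eq_integral => x /set_mem x01; rewrite gee0_abs// f0.
apply: negligibleS => x [x01 /= /eqP fx] H; apply: fx; exact: H.
Qed.

Lemma Mplus_indic (E : set R) : measurable E -> Mplus (fun x => ((\1_E x : R))%:E).
Proof.
move=> mE; split=> [|x _]; last by rewrite lee_fin.
by apply/measurable_EFinP; exact: measurable_indic.
Qed.

Lemma Mplus_one : Mplus (cst 1 : R -> \bar R).
Proof. by split=> // _; exact: measurable_cst. Qed.

(** The lower bound by the integral yields both definiteness and local integrability; finiteness on
    1 yields it on all indicators. *)
Lemma ri_norm_of_seminorm rho (c : R) : fatou_seminorm rho ->
  rearrangement_invariant rho -> rho (cst 1) < +oo -> (0 < c)%R ->
  (forall f, Mplus f -> c%:E * \int[mu]_(x in I01) f x <= rho f) -> ri_norm rho.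
Proof.
move=> s ri rho1 c0 H; have [s1 s2 s3 s4 s5] := s.
split=> //; split.
  move=> f Mf; split=> [rf0|]; last exact: seminorm_ae_zero.
  apply: integral_eq0_ae => //; apply/eqP; rewrite eq_le; apply/andP; split; last first.
    by apply: integral_ge0; exact: Mplus_ge0.
  by have := H _ Mf; rewrite rf0 pmule_rle0 ?lte_fin.
do 4 (split=> //); split.
  move=> E mE E01; apply: le_lt_trans rho1; apply: seminorm_le => //.
  - exact: Mplus_indic.
  - by move=> x _ /=; rewrite lee_fin indicE; case: (_ \in _).
split=> // E mE E01; exists (c^-1)%R => f Mf.
apply: (@le_trans _ _ (\int[mu]_(x in I01) f x)).
  by apply: ge0_subset_integral => //; [exact: measurable_I01|
    exact: Mplus_measurable|exact: Mplus_ge0].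
by rewrite -(@lee_pmul2l _ c%:E) ?lte_fin// muleA -EFinM mulfV ?gt_eqF// mul1e H.
Qed.

(** * Suprema and examples of seminorms *)

Definition sup_norm (Phi : set ((R -> \bar R) -> \bar R)) f :=
  ereal_sup [set phi f | phi in Phi].

Lemma le_sup_norm (Phi : set ((R -> \bar R) -> \bar R)) phi f :
  Phi phi -> phi f <= sup_norm Phi f.
Proof. by move=> Pphi; apply: ereal_sup_ubound; exists phi. Qed.

Lemma sup_norm_le (Phi : set ((R -> \bar R) -> \bar R)) f y :
  (forall phi, Phi phi -> phi f <= y) -> sup_norm Phi f <= y.
Proof. by move=> H; apply: ge_ereal_sup => _ [phi Pphi <-]; exact: H. Qed.

Lemma aeS (P Q : R -> Prop) : (forall x, P x -> Q x) ->
  {ae mu, forall x, P x} -> {ae mu, forall x, Q x}.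
Proof. by move=> PQ; apply: negligibleS => x; exact/contra_not/PQ. Qed.

Lemma nd_cvg_le (u : (\bar R)^nat) (l : \bar R) : (forall n, u n <= u n.+1) ->
  u @ \oo --> l -> forall n, u n <= l.
Proof.
move=> /nondecreasing_seqP ndu ul n.
have /cvg_lim <- // := ul; have /cvg_lim -> // := ereal_nondecreasing_cvgn ndu.
by apply: ereal_sup_ubound; exists n.
Qed.

Lemma fatou_seminorm_sup (Phi : set ((R -> \bar R) -> \bar R)) : Phi !=set0 ->
  (forall phi, Phi phi -> fatou_seminorm phi) -> fatou_seminorm (sup_norm Phi).
Proof.
move=> [phi0 Pphi0] sPhi; split.
- by move=> f Mf; apply: le_trans (le_sup_norm f Pphi0); apply: seminorm_ge0 => //; exact: sPhi.
- move=> f a Mf a0; rewrite /sup_norm -ereal_supZl//; last first.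
    by apply/set0P; exists (phi0 f), phi0.
  congr ereal_sup; apply/seteqP; split => [_ [phi Pphi <-]|_ [_ [phi Pphi <-] <-]].
    by exists (phi f); [exists phi|rewrite seminormZ//; exact: sPhi].
  by exists phi => //; rewrite seminormZ//; exact: sPhi.
- move=> f g Mf Mg; apply: sup_norm_le => phi Pphi.
  apply: (le_trans (seminormD (sPhi _ Pphi) Mf Mg)).
  by apply: leeD; exact: le_sup_norm.
- move=> f g Mf Mg fg; apply: sup_norm_le => phi Pphi.
  by apply: le_trans (le_sup_norm f Pphi); exact: (seminorm_le_ae (sPhi _ Pphi)).
- move=> fn f Mfn Mf fnf.
  have nd n : {ae mu, forall x, I01 x -> fn n x <= fn n.+1 x}.
    by apply: aeS fnf => x H x01; have [] := H x01.
  have lef n : {ae mu, forall x, I01 x -> fn n x <= f x}.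
    apply: aeS fnf => x H x01; have [ndx cx] := H x01.
    exact: (nd_cvg_le ndx cx).
  have ndphi phi : Phi phi -> nondecreasing_seq (phi \o fn).
    move=> Pphi; apply/nondecreasing_seqP => n /=.
    exact: (seminorm_le_ae (sPhi _ Pphi)).
  have nds : nondecreasing_seq (sup_norm Phi \o fn).
    apply/nondecreasing_seqP => n /=; apply: sup_norm_le => phi Pphi.
    apply: le_trans (le_sup_norm _ Pphi); exact: (ndphi _ Pphi).
  (* The sequence converges to its supremum over [n]; the Fatou property now says that the suprema
     over [n] and over [phi] commute. *)
  have := ereal_nondecreasing_cvgn nds; congr (_ --> _).
  apply/eqP; rewrite eq_le; apply/andP; split.
    apply: ge_ereal_sup => _ [n _ <-] /=; apply: sup_norm_le => phi Pphi.
    by apply: le_trans (le_sup_norm f Pphi); exact: (seminorm_le_ae (sPhi _ Pphi)).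
  apply: sup_norm_le => phi Pphi.
  have [_ _ _ _ /(_ fn f Mfn Mf fnf) cphi] := sPhi _ Pphi.
  rewrite -(cvg_lim _ cphi)//; apply: lime_le; first by apply/cvg_ex; exists (phi f).
  apply: nearW => n; apply: (le_trans (le_sup_norm (fn n) Pphi)).
  by apply: ereal_sup_ubound; exists n.
Qed.

Lemma fatou_seminormZ rho (a : R) : (0 <= a)%R -> fatou_seminorm rho ->
  fatou_seminorm (fun f => a%:E * rho f).
Proof.
move=> a0 [s1 s2 s3 s4 s5]; split.
- by move=> f Mf; rewrite mule_ge0 ?lee_fin ?s1.
- by move=> f c Mf c0; rewrite s2// muleCA.
- move=> f g Mf Mg; rewrite -ge0_muleDr ?s1//.
  by apply: lee_wpmul2l; [rewrite lee_fin|exact: s3].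
- by move=> f g Mf Mg fg; apply: lee_wpmul2l; [rewrite lee_fin|exact: s4].
- by move=> fn f Mfn Mf fnf; apply: cvgeZl => //; exact: s5.
Qed.

Lemma fatou_seminorm_integral b : Mplus b ->
  fatou_seminorm (fun f => \int[mu]_(x in I01) (b x * f x)).
Proof.
move=> Mb; split.
- by move=> f Mf; apply: integral_ge0; exact: (Mplus_ge0 (MplusM Mb Mf)).
- move=> f a Mf a0; have [mbf bf0] := MplusM Mb Mf.
  by rewrite -integralZ//; apply: eq_integral => x _; rewrite muleCA.
- move=> f g Mf Mg; have [mbf bf0] := MplusM Mb Mf; have [mbg bg0] := MplusM Mb Mg.
  rewrite -ge0_integralD//; last first.
    exact: measurable_I01.
  rewrite le_eqVlt; apply/orP; left; apply/eqP; apply: eq_integral => x /set_mem x01.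
  by rewrite ge0_muleDr//; [exact: Mplus_ge0 Mf _ x01|exact: Mplus_ge0 Mg _ x01].
- move=> f g Mf Mg fg; have [mbf bf0] := MplusM Mb Mf; have [mbg bg0] := MplusM Mb Mg.
  apply: ae_ge0_le_integral => //; first exact: measurable_I01.
  apply: aeS fg => x fg x01.
  by apply: lee_wpmul2l; [exact: Mplus_ge0|exact: fg].
(* The null set [A] where monotonicity or convergence may fail is cut out of the domain. *)
- move=> fn f Mfn Mf [A [mA muA fnf]].
  pose D := I01 `\` A; have mD : measurable D.
    by apply: measurableD => //; exact: measurable_I01.
  have DI : D `<=` I01 by exact: subDsetl.
  have good x : D x -> (forall n, fn n x <= fn n.+1 x) /\ fn ^~ x @ \oo --> f x.
    move=> [x01 nAx]; apply: contrapT => H; apply: nAx; apply: fnf => /= H'.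
    by apply: H; exact: H'.
  have restr w : Mplus w -> \int[mu]_(x in I01) (b x * w x) =
      \int[mu]_(x in D) (b x * w x).
    move=> Mw; have [mbw bw0] := MplusM Mb Mw.
    by apply: ge0_negligible_integral => //; exact: measurable_I01.
  rewrite restr// (_ : _ \o fn = fun n => \int[mu]_(x in D) (b x * fn n x)); last first.
    by apply/funext => n /=; rewrite restr.
  have -> : \int[mu]_(x in D) (b x * f x) =
      \int[mu]_(x in D) limn (fun n => b x * fn n x).
    apply: eq_integral => x /set_mem Dx; have [ndx cx] := good x Dx.
    apply/esym/cvg_lim => //; have x01 := DI _ Dx.
    (* The limit of the product is the product of the limits except for [0 * +oo]; if one factor of
       the limit is 0, all products are already 0. *)
    have [bx0|bx0] := eqVneq (b x) 0.
      by rewrite bx0 mul0e; under eq_fun do rewrite mul0e; exact: cvg_cst.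
    have [fx0|fx0] := eqVneq (f x) 0.
      have fn0 n : fn n x = 0.
        apply/eqP; rewrite eq_le (Mplus_ge0 (Mfn n) x01) andbT -fx0.
        exact: (nd_cvg_le ndx cx).
      by rewrite fx0 mule0; under eq_fun do rewrite fn0 mule0; exact: cvg_cst.
    apply: cvgeM => //; last exact: cvg_cst.
    by rewrite mule_defE (negbTE bx0) (negbTE fx0).
  apply: cvg_monotone_convergence => //.
  + move=> n; have [mbw _] := MplusM Mb (Mfn n).
    exact: (measurable_funS (@measurable_I01 R) DI mbw).
  + by move=> n x /DI; exact: (Mplus_ge0 (MplusM Mb (Mfn n))).
  + move=> x Dx; have [ndx _] := good x Dx; apply/nondecreasing_seqP => n.
    by apply: lee_wpmul2l; [exact: Mplus_ge0 Mb _ (DI _ Dx)|exact: ndx].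
Qed.

End fatou_seminorms.

(** * The optimal target *)

Section optimal_target.
Variable R : realType.
Local Notation mu := (@lebesgue_measure R).
Local Notation I01 := (@Defs.I01 R).
Implicit Types (b f g h u v w : R -> \bar R).
Implicit Types (rho phi : (R -> \bar R) -> \bar R).
Local Hint Resolve measurable_I01 : core.

Lemma hoelder_assoc rho g v : ri_norm rho -> Mplus g -> Mplus v -> rho g < +oo ->
  \int[mu]_(x in I01) (g x * v x) <= rho g * assoc rho v.
Proof.
move=> rirho Mg Mv gfin; have s := ri_norm_fatou rirho.
have g0 : 0 <= rho g by exact: seminorm_ge0.
(* A [g] of norm 0 cannot be normalized, but it vanishes almost everywhere and so does the
   integrand. *)
have [rg0|rg0] := eqVneq (rho g) 0.
  have [_ [/(_ g Mg)[/(_ rg0) g_ae _] _]] := rirho.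
  have sv := fatou_seminorm_integral Mv.
  under eq_integral do rewrite muleC.
  by rewrite (seminorm_ae_zero sv Mg g_ae) rg0 mul0e.
have fin : rho g \is a fin_num by rewrite ge0_fin_numE.
pose r := fine (rho g); have rE : rho g = r%:E by rewrite fineK.
have r0 : (0 < r)%R by rewrite -lte_fin -rE lt0e rg0.
have ri0 : (0 <= r^-1)%R by rewrite invr_ge0 ltW.
have [m p] := MplusM Mg Mv.
rewrite rE -(@lee_pmul2l _ (r^-1)%:E) ?lte_fin ?invr_gt0// muleA -EFinM mulVf ?gt_eqF// mul1e.
rewrite -integralZ//; under eq_integral do rewrite muleA.
apply: (@integral_le_assoc _ rho (fun x => (r^-1)%:E * g x)); first exact: MplusZ.
by rewrite seminormZ// rE -EFinM mulVf ?gt_eqF.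
Qed.

Lemma ri_norm_integral_le rho : ri_norm rho -> exists2 C : R, (0 < C)%R &
  forall f, Mplus f -> \int[mu]_(x in I01) f x <= C%:E * rho f.
Proof.
move=> rirho; have [_ [_ [_ [_ [_ [_ [_ [H _]]]]]]]] := rirho.
have [C HC] := H I01 (@measurable_I01 R) (@subset_refl _ _).
exists (Num.max C 1%R) => [|f Mf]; first by rewrite lt_max ltr01 orbT.
apply: (le_trans (HC f Mf)); apply: lee_wpmul2r; last by rewrite lee_fin le_max lexx.
exact: seminorm_ge0 (ri_norm_fatou rirho) Mf.
Qed.

Lemma assoc_ge0 rho v : ri_norm rho -> Mplus v -> 0 <= assoc rho v.
Proof.
move=> rirho Mv; have M0 : Mplus (cst 0%:E : R -> \bar R) by exact: Mplus_cst.
apply: le_trans (integral_le_assoc v M0 _).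
  by apply: integral_ge0; exact: (Mplus_ge0 (MplusM M0 Mv)).
rewrite (seminorm_ae_zero (ri_norm_fatou rirho))//.
by apply: negligibleS (negligible_set0 mu) => x [_ /=]; rewrite eqxx.
Qed.

Lemma assoc_embed rho1 rho2 g (C : R) : fatou_seminorm rho1 -> (0 < C)%R ->
  (forall f, Mplus f -> rho1 f <= C%:E * rho2 f) -> Mplus g ->
  assoc rho2 g <= C%:E * assoc rho1 g.
Proof.
move=> s C0 H Mg; apply: assoc_le => f Mf f1.
have Ci0 : (0 <= C^-1)%R by rewrite invr_ge0 ltW.
have [m p] := MplusM Mf Mg.
rewrite -(@lee_pmul2l _ (C^-1)%:E) ?lte_fin ?invr_gt0// muleA -EFinM mulVf ?gt_eqF// mul1e.
rewrite -integralZ//; under eq_integral do rewrite muleA.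
apply: (@integral_le_assoc _ rho1 (fun x => (C^-1)%:E * f x)); first exact: MplusZ.
rewrite seminormZ// -(@lee_pmul2l _ C%:E) ?lte_fin// muleA -EFinM mulfV ?gt_eqF// mul1e mule1.
apply: (le_trans (H f Mf)); rewrite -[leRHS]mule1.
by apply: lee_wpmul2l => //; rewrite lee_fin ltW.
Qed.

Lemma eq_distr_indic (A B : set R) l : A `<=` I01 -> B `<=` I01 -> mu A = mu B ->
  distr (fun x => ((\1_A x : R))%:E) l = distr (fun x => ((\1_B x : R))%:E) l.
Proof.
move=> A01 B01 AB.
have E (S : set R) : S `<=` I01 -> distr (fun x => ((\1_S x : R))%:E) l =
    if (l < 0)%R then mu I01 else if (l < 1)%R then mu S else 0.
  move=> S01; rewrite distrE; case: ltP => l0.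
    congr (mu _); apply/seteqP; split => [x []//|x x01]; split=> //=.
    by rewrite lte_fin (lt_le_trans l0).
  case: ltP => l1.
    congr (mu _); apply/seteqP; split => [x [_ /=]|x Sx].
      by rewrite lte_fin indicE; case: (boolP (x \in S)) => [/set_mem//|_]; rewrite ltNge l0.
    by split=> /=; [exact: S01|rewrite lte_fin indicE mem_set].
  rewrite [X in mu X](_ : _ = set0) ?measure0//; apply/seteqP; split => x // [_ /=].
  by rewrite lte_fin indicE; case: (_ \in _); rewrite ltNge ?l1 ?l0.
by rewrite !E// AB.
Qed.

Section optimal.
Variables (I : R -> R) (rho : (R -> \bar R) -> \bar R).
Hypotheses (qI : quasiconcave I) (rirho : ri_norm rho).

Let N f := assoc rho (avgI I f).
Let srho := ri_norm_fatou rirho.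

Lemma avgI_one_le t : I01 t -> avgI I (cst 1) t <= 1.
Proof.
move=> t01; have It0 := qc_gt0 qI t01; have := t01; rewrite I01P => /andP[t0 t1].
rewrite -(@lee_pmul2l _ (I t)%:E) ?lte_fin// mul_avgI// mule1.
apply: (@le_trans _ _ (\int[mu]_(s in `]0%R, t[) 1)).
  apply: ge0_le_integral => //.
  - by move=> s _; exact: fstar_ge0.
  - exact: (measurable_funS (@measurable_I01 R) (subset_itv0_I01 t01)
             (Mplus_measurable (Mplus_fstar (cst 1)))).
  - move=> s; rewrite /= in_itv/= => /andP[s0 _].
    apply: ereal_inf_lbound; exists 1%R => //; split=> //.
    rewrite distrE [X in mu X](_ : _ = set0) ?measure0 ?lee_fin ?ltW//.
    by apply/seteqP; split=> x // [_ /=]; rewrite ltxx.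
have -> : \int[mu]_(s in `]0%R, t[) 1 = mu `]0%R, t[%classic :> \bar R.
  transitivity (1 * mu `]0%R, t[%classic); last by rewrite mul1e.
  by rewrite -integral_cst.
by rewrite lebesgue_measure_itv/= lte_fin t0 oppr0 adde0 lee_fin qc_ge_id.
Qed.

Lemma avg_norm_one : exists2 C : R, (0 < C)%R & N (cst 1) <= C%:E.
Proof.
have [C C0 HC] := ri_norm_integral_le rirho; exists C => //.
apply: assoc_le => g Mg g1.
apply: (@le_trans _ _ (\int[mu]_(x in I01) (g x * cst 1 x))).
  apply: le_integral_mul; [exact: Mg|exact: Mplus_avgI|exact: Mplus_one|].
  by move=> x; exact: avgI_one_le.
under eq_integral do rewrite mule1.
apply: (le_trans (HC _ Mg)); rewrite -[leRHS]mule1.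
by apply: lee_wpmul2l => //; rewrite lee_fin ltW.
Qed.

(** The supremum of these functionals is the associate norm of [N]. Keeping the scale [k] outside
    [N] spares the homogeneity of $f \mapsto f^*$. *)
Definition avg_dual : set ((R -> \bar R) -> \bar R) :=
  [set phi | exists (k : R) (b : R -> \bar R), [/\ (0 < k)%R, Mplus b, k%:E * N b <= 1 &
     phi = fun h => \int[mu]_(x in I01) ((k%:E * b x) * h x)]].

Lemma avg_dual_seminorm phi : avg_dual phi -> fatou_seminorm phi.
Proof.
move=> [k [b [k0 Mb _ ->]]]; apply: fatou_seminorm_integral.
by apply: MplusZ => //; exact: ltW.
Qed.

Lemma integral_scale (a : R) b h : (0 <= a)%R -> Mplus b -> Mplus h ->
  \int[mu]_(x in I01) ((a%:E * b x) * h x) = a%:E * \int[mu]_(x in I01) (b x * h x).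
Proof.
move=> a0 Mb Mh; have [m p] := MplusM Mb Mh.
by rewrite -integralZ//; apply: eq_integral => x _; rewrite muleA.
Qed.

(** A multiple of the plain integral is admissible; later this is the lower bound that makes the
    optimal norm nondegenerate. *)
Lemma avg_dual_one : exists2 c : R, (0 < c)%R &
  avg_dual (fun h => \int[mu]_(x in I01) ((c%:E * cst 1 x) * h x)).
Proof.
have [C C0 NC] := avg_norm_one; exists (C^-1)%R; first by rewrite invr_gt0.
exists (C^-1)%R, (cst 1); split=> //; rewrite ?invr_gt0//.
by rewrite -(@lee_pmul2l _ C%:E) ?lte_fin// muleA -EFinM mulfV ?gt_eqF// mul1e mule1.
Qed.

Lemma fatou_seminorm_avg_dual : fatou_seminorm (sup_norm avg_dual).
Proof.
apply: fatou_seminorm_sup; last exact: avg_dual_seminorm.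
by have [c _ H] := avg_dual_one; eexists; exact: H.
Qed.

(** [N] sees only $b^*$, so [b] may be exchanged for its rearrangement aligned with [h2]. *)
Lemma avg_dual_invariant : rearrangement_invariant (sup_norm avg_dual).
Proof.
suff le h1 h2 : Mplus h1 -> Mplus h2 -> (forall l, distr h1 l = distr h2 l) ->
    sup_norm avg_dual h1 <= sup_norm avg_dual h2.
  by move=> h1 h2 M1 M2 h12; apply/eqP; rewrite eq_le !le.
move=> M1 M2 h12; apply: sup_norm_le => _ [k [b [k0 Mb kb ->]]].
have [b' [Mb' b'b H]] := resonance Mb M2.
apply: (@le_trans _ _ (\int[mu]_(x in I01) ((k%:E * b' x) * h2 x))).
  rewrite !integral_scale ?(ltW k0)//; apply: lee_wpmul2l; first by rewrite lee_fin ltW.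
  rewrite -[leRHS]mul1e; apply: H => // m _.
  by rewrite mul1e h12.
apply: (@le_sup_norm _ avg_dual (fun h => \int[mu]_(x in I01) ((k%:E * b' x) * h x))).
have Nb : N b' = N b by rewrite /N /avgI (eq_fstar b'b).
by exists k, b'; split; [exact: k0|exact: Mb'|rewrite Nb; exact: kb|reflexivity].
Qed.

(** For the average $u = I^{-1} \int_0^t b^*$: $\int b\, Hg \le \int b^* Hg = \int g u \le \|g\|_X
    N(b)$. *)
Lemma avg_dual_H_I g : Mplus g -> sup_norm avg_dual (H_I I g) <= rho g.
Proof.
move=> Mg; have [->|gfin] := eqVneq (rho g) +oo; first exact: leey.
have MH := Mplus_H_I qI Mg; have g0 := seminorm_ge0 srho Mg.
apply: sup_norm_le => _ [k [b [k0 Mb kb ->]]].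
rewrite integral_scale ?(ltW k0)//.
apply: (@le_trans _ _ (k%:E * (rho g * N b))).
  apply: lee_wpmul2l; first by rewrite lee_fin ltW.
  apply: (@le_trans _ _ (\int[mu]_(x in I01) (fstar b x * H_I I g x))).
    apply: nincr01_le => //; [exact: nincr01_fstar|exact: nincr01_H_I|
      exact: Mplus_fstar|by move=> l _; rewrite distr_fstar].
  rewrite -integral_avgI//; apply: hoelder_assoc => //; first exact: Mplus_avgI.
  by rewrite ltey.
by rewrite muleCA -[leRHS]mule1; apply: lee_wpmul2l.
Qed.

Definition range_norms : set ((R -> \bar R) -> \bar R) :=
  [set phi | [/\ fatou_seminorm phi, rearrangement_invariant phi &
    forall g, Mplus g -> phi (H_I I g) <= rho g]].

Lemma range_norms_avg_dual : range_norms (sup_norm avg_dual).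
Proof.
by split; [exact: fatou_seminorm_avg_dual|exact: avg_dual_invariant|exact: avg_dual_H_I].
Qed.

Definition optimal_norm := sup_norm range_norms.

Lemma fatou_seminorm_optimal : fatou_seminorm optimal_norm.
Proof.
apply: fatou_seminorm_sup => [|phi []//].
by eexists; exact: range_norms_avg_dual.
Qed.

Lemma optimal_norm_invariant : rearrangement_invariant optimal_norm.
Proof.
move=> f g Mf Mg fg; congr ereal_sup; apply/seteqP.
by split=> _ [phi Pphi <-]; exists phi => //; have [_ ri _] := Pphi;
  [apply/esym|]; exact: ri.
Qed.

Lemma optimal_norm_H_I g : Mplus g -> optimal_norm (H_I I g) <= rho g.
Proof. by move=> Mg; apply: sup_norm_le => phi [_ _ H]; exact: H. Qed.

(** The two halves of $(0,1)$ are equimeasurable, and since $1/I \ge 1$ the image under $H$ of the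
    indicator of the upper half is at least $1/2$ on the lower half. *)
Let upper := `](2^-1)%R, 1%R[%classic : set R.
Let lower := `]0%R, (2^-1)%R]%classic : set R.

Let upper01 : upper `<=` I01.
Proof. by move=> x; rewrite /upper/= in_itv/= I01P => /andP[x2 ->]; rewrite andbT; lra. Qed.

Let lower01 : lower `<=` I01.
Proof. by move=> x; rewrite /lower/= in_itv/= I01P => /andP[-> x2] /=; lra. Qed.

Let indic_lower_le x : I01 x ->
  ((\1_lower x : R))%:E <= 2%:E * H_I I (fun x => ((\1_upper x : R))%:E) x.
Proof.
move=> x01; have MU := Mplus_indic (measurable_itv `](2^-1)%R, 1%R[ : measurable upper).
have MI := MplusM MU (Mplus_invI qI).
rewrite indicE; case: (boolP (x \in lower)) => [/set_mem/= xl|_]; last first.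
  by rewrite mule_ge0 ?lee_fin//; exact: Mplus_ge0 (Mplus_H_I qI MU) _ x01.
move: xl; rewrite /lower/= in_itv/= => /andP[x0 x2].
rewrite -[(true%:R)%:E](_ : 2%:E * mu upper = _); last first.
  rewrite lebesgue_measure_itv/= lte_fin ifT; last lra.
  by rewrite -EFinB -EFinM; congr EFin; rewrite /=; lra.
apply: lee_wpmul2l; first by rewrite lee_fin.
have ux : upper `<=` `]x, 1%R[.
  by move=> y; rewrite /upper/= !in_itv/= => /andP[y2 ->]; rewrite andbT; exact: le_lt_trans y2.
apply: (@le_trans _ _ (\int[mu]_(s in upper) ((\1_upper s)%:E * ((I s)^-1)%:E))); last first.
  apply: ge0_subset_integral => //; first exact: measurable_itv.
  - exact: (measurable_funS (@measurable_I01 R) (subset_itv1_I01 x01) (Mplus_measurable MI)).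
  - by move=> y /(subset_itv1_I01 x01); exact: Mplus_ge0 MI y.
have -> : mu upper = \int[mu]_(s in upper) 1.
  by rewrite integral_cst ?mul1e//; exact: measurable_itv.
apply: ge0_le_integral => //; first exact: measurable_itv.
- exact: (measurable_funS (@measurable_I01 R) upper01 (Mplus_measurable MI)).
- move=> s us; have s01 := upper01 us.
  rewrite indicE mem_set// mul1e lee_fin invf_ge1 ?qc_gt0//.
  by apply/ltW/qc_lt1.
Qed.

Lemma optimal_norm_one : optimal_norm (cst 1) < +oo.
Proof.
have mU : measurable upper by exact: measurable_itv.
have mL : measurable lower by exact: measurable_itv.
have MU := Mplus_indic mU; have ML := Mplus_indic mL.
have MH := Mplus_H_I qI MU.
have fin := ri_norm_indic rirho mU upper01.
set U := (fun x => ((\1_upper x : R))%:E) in MU MH fin *.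
(* Each half of the constant function 1 costs [2 * rho U]: the lower one through [indic_lower_le],
   the upper one by rearrangement invariance. The bound is uniform in [phi]. *)
apply: (@le_lt_trans _ _ (4%:E * rho U)); last first.
  by rewrite lte_mul_pinfty//; exact: seminorm_ge0.
apply: sup_norm_le => phi [s ri H].
have lowU : phi (fun x => ((\1_lower x : R))%:E) <= 2%:E * rho U.
  apply: (@le_trans _ _ (phi (fun x => 2%:E * H_I I U x))).
    by apply: seminorm_le => //; exact: MplusZ.
  by rewrite seminormZ//; apply: lee_wpmul2l; [rewrite lee_fin|exact: H].
have UL : phi U = phi (fun x => ((\1_lower x : R))%:E).
  apply: ri => // l; apply: eq_distr_indic => //.
  rewrite !lebesgue_measure_itv/= !lte_fin !ifT ?invr_gt0//; last lra.
  by rewrite -!EFinB; congr EFin; lra.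
apply: (@le_trans _ _ (phi ((fun x => ((\1_lower x : R))%:E) \+ U))).
  apply: seminorm_le => //.
  - by split; [apply: emeasurable_funD; exact: Mplus_measurable|
      move=> x x01; rewrite adde_ge0//; exact: Mplus_ge0].
  - move=> x x01 /=; rewrite /U !indicE -EFinD lee_fin.
    have [xl|xl] := leP x (2^-1)%R.
      rewrite mem_set ?lerDl// /lower/= in_itv/= xl andbT.
      by move: x01; rewrite I01P => /andP[].
    rewrite [x \in upper]mem_set ?lerDr// /upper/= in_itv/= xl.
    by move: x01; rewrite I01P => /andP[].
apply: (le_trans (seminormD s ML MU)); rewrite UL.
have -> : (4 = 2 + 2 :> R)%R by lra.
by rewrite EFinD ge0_muleDl ?lee_fin//; apply: leeD.
Qed.

Lemma ri_norm_optimal : ri_norm optimal_norm.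
Proof.
have [c c0 Hc] := avg_dual_one.
apply: (@ri_norm_of_seminorm _ _ c) => //.
- exact: fatou_seminorm_optimal.
- exact: optimal_norm_invariant.
- exact: optimal_norm_one.
move=> f Mf; apply: le_trans (le_sup_norm f range_norms_avg_dual).
apply: le_trans (le_sup_norm f Hc).
rewrite integral_scale ?(ltW c0)//.
by under [in leRHS]eq_integral do rewrite mul1e.
Qed.

(** Divided by a positive bound for $H$, [phi] is one of the seminorms in the supremum. *)
Lemma optimal_norm_embeds phi : ri_norm phi -> bounded_op (H_I I) rho phi ->
  embeds optimal_norm phi.
Proof.
move=> riphi [C HC]; have sphi := ri_norm_fatou riphi.
pose D := Num.max C 1%R; have D0 : (0 < D)%R by rewrite lt_max ltr01 orbT.
have Di0 : (0 <= D^-1)%R by rewrite invr_ge0 ltW.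
have P : range_norms (fun h => (D^-1)%:E * phi h).
  split; first exact: fatou_seminormZ.
    by move=> f g Mf Mg fg; rewrite (ri_norm_invariant riphi Mf Mg).
  move=> g Mg; rewrite -(@lee_pmul2l _ D%:E) ?lte_fin// muleA -EFinM mulfV ?gt_eqF// mul1e.
  apply: (le_trans (HC _ Mg)); apply: lee_wpmul2r; first exact: seminorm_ge0.
  by rewrite lee_fin le_max lexx.
exists D => f Mf.
rewrite -(@lee_pmul2l _ (D^-1)%:E) ?lte_fin ?invr_gt0// muleA -EFinM mulVf ?gt_eqF// mul1e.
exact: (le_sup_norm f P).
Qed.

Lemma optimal_target_norm : optimal_target I rho optimal_norm.
Proof.
split; [exact: ri_norm_optimal|split; last exact: optimal_norm_embeds].
by exists 1%R => f Mf; rewrite mul1e; exact: optimal_norm_H_I.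
Qed.

Lemma assoc_optimal_norm f : Mplus f -> assoc optimal_norm f = N f.
Proof.
move=> Mf; apply/eqP; rewrite eq_le; apply/andP; split; apply: assoc_le.
  move=> h Mh h1.
  (* [N f] may be 0 and then cannot be inverted; any positive bound [d] can, and [N f + e] with
     small [e] is such a bound. *)
  have key (d : R) : (0 < d)%R -> N f <= d%:E -> \int[mu]_(x in I01) (h x * f x) <= d%:E.
    move=> d0 Nd; under eq_integral do rewrite muleC.
    rewrite -(@lee_pmul2l _ (d^-1)%:E) ?lte_fin ?invr_gt0// -EFinM mulVf ?gt_eqF//.
    have di0 : (0 <= d^-1)%R by rewrite invr_ge0 ltW.
    rewrite -integral_scale//; apply: le_trans h1.
    apply: le_trans (le_sup_norm h range_norms_avg_dual).
    apply: (@le_sup_norm _ avg_dual (fun h => \int[mu]_(x in I01) (((d^-1)%:E * f x) * h x))).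
    exists (d^-1)%R, f; split=> //; rewrite ?invr_gt0//.
    by rewrite -(@lee_pmul2l _ d%:E) ?lte_fin// muleA -EFinM mulfV ?gt_eqF// mul1e mule1.
  have N0 : 0 <= N f by apply: assoc_ge0 => //; exact: Mplus_avgI.
  case NE : (N f) N0 key => [n| |] // N0 key; last exact: leey.
  apply/lee_addgt0Pr => e e0; rewrite -EFinD; apply: key.
    by rewrite ltr_wpDl// -lee_fin.
  by rewrite lee_fin lerDl ltW.
move=> g Mg g1; rewrite integral_avgI//; have MH := Mplus_H_I qI Mg.
(* [h] is a rearrangement of [H_I I g] aligned with [f]; invariance keeps it in the unit ball of
   [optimal_norm]. *)
have [h [Mh hH]] := resonance MH Mf.
move=> /(_ 1%R (H_I I g) (fstar f)) H.
apply: (@le_trans _ _ (\int[mu]_(x in I01) (h x * f x))).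
  under eq_integral do rewrite muleC.
  rewrite -[leRHS]mul1e; apply: H => //; first exact: Mplus_fstar.
  by move=> m _; rewrite mul1e distr_fstar.
apply: integral_le_assoc => //.
rewrite (optimal_norm_invariant Mh MH hH).
exact: le_trans (optimal_norm_H_I Mg) g1.
Qed.

(** By minimality, two optimal targets embed into each other, and duality reverses both
    embeddings. *)
Lemma assoc_optimal_target_equiv rhoY : optimal_target I rho rhoY ->
  equiv_on_Mplus (assoc rhoY) N.
Proof.
move=> [riY [bY embY]].
have pos rho1 rho2 : ri_norm rho1 -> embeds rho1 rho2 -> exists2 C : R, (0 < C)%R &
    forall C', (C <= C')%R -> forall f, Mplus f -> rho2 f <= C'%:E * rho1 f.
  move=> ri1 [C HC]; exists (Num.max C 1%R) => [|C' CC' f Mf].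
    by rewrite lt_max ltr01 orbT.
  apply: (le_trans (HC f Mf)); apply: lee_wpmul2r.
    exact: seminorm_ge0 (ri_norm_fatou ri1) Mf.
  by rewrite lee_fin (le_trans _ CC')// le_max lexx.
have [C1 C10 H1] := pos _ _ ri_norm_optimal (optimal_norm_embeds riY bY).
have [_ [bO _]] := optimal_target_norm.
have [C2 C20 H2] := pos _ _ riY (embY _ ri_norm_optimal bO).
have C0 : (0 < Num.max C1 C2)%R by rewrite lt_max C10.
exists (Num.max C1 C2); split=> // f Mf; rewrite -(assoc_optimal_norm Mf); split.
  apply: assoc_embed => //; first exact: fatou_seminorm_optimal.
  by apply: H2; rewrite le_max lexx orbT.
apply: assoc_embed => //; first exact: ri_norm_fatou.
by apply: H1; rewrite le_max lexx.
Qed.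

End optimal.

End optimal_target.

Theorem theorem4p5 (R : realType) (I : R -> R)
  (rhoX : (R -> \bar R) -> \bar R) :
  quasiconcave I ->
  (exists C : R, forall t, I01 t ->
     \int[@lebesgue_measure R]_(s in `]0%R, t[) ((I s / s)%R)%:E
       <= C%:E * (I t)%:E) ->
  ri_norm rhoX ->
  let Znorm := fun f => assoc rhoX (S_I I f) in
  (* ||f||_{(Y_X)'} = ||(1/I(t)) int_0^t f^*||_{X'} for the optimal target Y_X *)
  (exists rhoY, optimal_target I rhoX rhoY /\
     forall f, Mplus f -> assoc rhoY f = assoc rhoX (avgI I f)) /\
  (* every optimal target norm is equivalent to it *)
  (forall rhoY, optimal_target I rhoX rhoY ->
     equiv_on_Mplus (assoc rhoY) (fun f => assoc rhoX (avgI I f))) /\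
  (* ||(1/I) int_0^t f^*||_{X'} \approx ||(1/I) int_0^t f^*||_Z *)
  equiv_on_Mplus (fun f => assoc rhoX (avgI I f)) (fun f => Znorm (avgI I f)) /\
  (* S_I is bounded on Z *)
  bounded_op (S_I I) Znorm Znorm.

Proof.
move=> qI _ rirho Znorm; have ri := ri_norm_invariant rirho.
split; last split; last split.
- exists (optimal_norm I rhoX); split; first exact: optimal_target_norm.
  by move=> f Mf; exact: assoc_optimal_norm.
- by move=> rhoY; exact: assoc_optimal_target_equiv.
(* One constant serves both directions: 4 comes from the bound for $S_I$ on averages, while the
   reverse inequality holds with 1. *)
- exists 4%R; split=> // f Mf; have Mu := Mplus_avgI qI f; split.
    apply: (le_trans (assoc_le_S_I qI ri Mu)).
    apply: lee_pemull; last by rewrite lee_fin; lra.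
    by apply: assoc_ge0 => //; exact: Mplus_S_I.
  exact: assoc_S_I_avgI_le.
- by exists 1%R => f Mf; rewrite mul1e; exact: assoc_S_I_idem_le.
Qed.
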